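(* Let $N\ge 1$, $m\in\{2,3,\dots\}$ and $p\ge p_m:=1+2m/N$. Then there exists $\gamma_1=\gamma_1(N,m,p)>0$ such that, if $\mu$ is a nonnegative measurable function in $\mathbf{R}^N$ satisfying $$\mu(x)\ge \gamma_1|x|^{-N}\left[\log\left(e+\frac{1}{|x|}\right)\right]^{-\frac{N}{2m}-1}\quad\text{if } p=p_m,$$ $$\mu(x)\ge \gamma_1|x|^{-\frac{2m}{p-1}}\quad\text{if } p>p_m,$$ for all $x\neq 0$ in a neighborhood of the origin, then the Cauchy problem $$\partial_t u+(-\Delta)^m u=|u|^p,\qquad u(\cdot,0)=\mu$$ possesses no local-in-time solutions, that is, for no $T>0$ does it possess a solution in $\mathbf{R}^N\times[0,T)$.
   Context: $B(x,R):=\{y\in\mathbf{R}^N:|x-y|<R\}$. A nonnegative measurable function $\mu$ is identified with the measure $\mu(x)\,dx$. Definition of solution: let $T>0$ and let $u$ be a real-valued locally integrable function in $\mathbf{R}^N\times[0,T)$. We say that $u$ is a solution in $\mathbf{R}^N\times[0,T)$ of the Cauchy problem $\partial_t u+(-\Delta)^m u=|u|^p$, $u(\cdot,0)=\mu$, if $$-\int_{\mathbf{R}^N}\varphi(x,0)\,d\mu(x)+\int_0^T\int_{\mathbf{R}^N}\left[-u\,\partial_t\varphi+u(-\Delta)^m\varphi\right]dx\,dt=\int_0^T\int_{\mathbf{R}^N}|u|^p\varphi\,dx\,dt$$ for all $\varphi\in C^\infty(\mathbf{R}^N\times[0,T))$ with $\mathrm{supp}\,\varphi\subset B(0,R)\times[0,T-\epsilon]$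 for some $R>0$ and $0<\epsilon<T$; all integrals here are required to be well defined and finite. *)

(* Defs.v *)
From HB Require Import structures.
From mathcomp Require Import all_boot all_order all_algebra.
From mathcomp Require Import all_classical all_reals all_analysis.
Set Implicit Arguments.
Unset Strict Implicit.
Unset Printing Implicit Defensive.
Import Order.TTheory GRing.Theory Num.Theory.
Import numFieldNormedType.Exports.
Local Open Scope classical_set_scope.
Local Open Scope ring_scope.

(* R^N is 'rV[R]_N, and R^N x R (space x time) is 'rV[R]_N * R.               *)

Definition enorm (R : realType) (n : nat) (x : 'rV[R]_n) : R :=
  Num.sqrt (\sum_(i < n) x 0 i ^+ 2).

(* The library's norm on 'rV[R]_n is the sup norm, so its "ball" is not this. *)
Definition eball (R : realType) (n : nat) (x : 'rV[R]_n) (r : R) :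
    set 'rV[R]_n := [set y | enorm (x - y) < r].

Section measurable_row.
Context (R : realType) (n : nat).

Let coord : 'I_n -> 'rV[R]_n -> R := fun i x => x 0 i.

Let row_set0 : g_sigma_preimage coord set0.
Proof. exact: sigma_algebra0. Qed.

Let row_setC A : g_sigma_preimage coord A -> g_sigma_preimage coord (~` A).
Proof. exact: sigma_algebraC. Qed.

Let row_bigcup (F : _^nat) : (forall i, g_sigma_preimage coord (F i)) ->
  g_sigma_preimage coord (\bigcup_i (F i)).
Proof. exact: sigma_algebra_bigcup. Qed.

(* The product sigma-algebra, that is, the Borel sets of R^n. *)
HB.instance Definition _ := @isMeasurable.Build default_measure_display
  'rV[R]_n (g_sigma_preimage coord) row_set0 row_setC row_bigcup.

Lemma measurable_fun_row d (T : measurableType d) (f : T -> 'rV[R]_n) :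
  (forall i, measurable_fun [set: T] (fun t => f t 0 i)) ->
  measurable_fun [set: T] f.
Proof.
move=> mf.
suff H : g_sigma_preimage (fun i => coord i \o f) `<=` measurable.
  move=> _ A mA; apply: H; rewrite g_sigma_preimage_comp; exists A => //.
apply: smallest_sub; first exact: sigma_algebra_measurable.
rewrite -bigcup_seq/=; apply: bigcup_sub => i _ _ [B mB <-]; exact: mf.
Qed.

Lemma measurable_coord (i : 'I_n) :
  measurable_fun [set: 'rV[R]_n] (fun x => x 0 i).
Proof.
move=> _ Y mY; apply: sub_sigma_algebra.
by rewrite -bigcup_seq/=; exists i => /=; [rewrite mem_index_enum|exists Y].
Qed.

End measurable_row.

Section lebesgue_row.
Context (R : realType).

Definition row_cons (n : nat) (z : 'rV[R]_n * R) : 'rV[R]_n.+1 :=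
  row_mx (const_mx z.2 : 'rV[R]_1) z.1.

Lemma measurable_row_cons n : measurable_fun setT (@row_cons n).
Proof.
apply: measurable_fun_row => i; rewrite /row_cons.
under eq_fun do rewrite mxE.
case: splitP => j _ /=.
  by under eq_fun do rewrite mxE; exact: measurable_snd.
exact: (measurableT_comp (measurable_coord j) measurable_fst).
Qed.

Definition lebesgue_row_succ (n : nat)
    (m : {measure set 'rV[R]_n -> \bar R}) : set 'rV[R]_n.+1 -> \bar R :=
  pushforward (m \x @lebesgue_measure R)%E (@row_cons n).

HB.instance Definition _ n m := Measure.copy (@lebesgue_row_succ n m)
  (measure_function_pushforward__canonical__measure_function_Measure
     (m \x @lebesgue_measure R)%E (@measurable_row_cons n)).

(* Lebesgue measure on the Borel sets of R^n, one coordinate at a time. *)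
Fixpoint borel_lebesgue_row (n : nat) : {measure set 'rV[R]_n -> \bar R} :=
  match n with
  | 0 => @dirac _ 'rV[R]_0 0 R
  | n'.+1 => @lebesgue_row_succ n' (borel_lebesgue_row n')
  end.

Lemma row_cons_lift n z (i : 'I_n) : @row_cons n z 0 (lift ord0 i) = z.1 0 i.
Proof.
have -> : lift ord0 i = rshift 1 i by exact: ord_inj.
exact: row_mxEr.
Qed.

Lemma row_cons_ord0 n z : @row_cons n z 0 ord0 = z.2.
Proof.
have -> : ord0 = lshift n (ord0 : 'I_1) by exact: ord_inj.
by rewrite [LHS]row_mxEl mxE.
Qed.

Lemma borel_lebesgue_row_box n (A : 'I_n -> set R) :
  (forall i, measurable (A i)) ->
  borel_lebesgue_row n [set x : 'rV[R]_n | forall i, A i (x 0 i)] =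
  (\prod_(i < n) @lebesgue_measure R (A i))%E.
Proof.
elim: n A => [|n IHn] A mA.
  by rewrite big_ord0 /= diracE mem_set// => -[].
rewrite big_ord_recl /= /lebesgue_row_succ /pushforward.
pose B (i : 'I_n) := A (lift ord0 i).
have -> : @row_cons n @^-1` [set x : 'rV[R]_n.+1 | forall i, A i (x 0 i)] =
    [set x : 'rV[R]_n | forall i, B i (x 0 i)] `*` A ord0.
  apply/seteqP; split => -[x t] /=.
    by move=> H; split=> [i|]; [have := H (lift ord0 i)|have := H ord0];
      rewrite ?row_cons_lift ?row_cons_ord0.
  by move=> [Hx Ht] i; case: (unliftP ord0 i) => [j|] ->;
    rewrite ?row_cons_lift ?row_cons_ord0//; exact: Hx.
rewrite product_measure1E//; last exact: mA.
  by rewrite muleC; congr (_ * _)%E; apply: IHn => i; exact: mA.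
have -> : [set x : 'rV[R]_n | forall i, B i (x 0 i)] =
    \big[setI/setT]_(i < n) [set x : 'rV[R]_n | B i (x 0 i)].
  rewrite -bigcap_seq/=; apply/seteqP; split=> x /= H i; first by move=> _; exact: H.
  by apply: H => //=; rewrite mem_index_enum.
apply: bigsetI_measurable => i _; rewrite -[X in measurable X]setTI.
by apply: measurable_coord => //; exact: mA.
Qed.

(* Lebesgue measure proper, on the Lebesgue measurable sets (the Caratheodory *)
(* measurable sets of the outer measure).                                     *)
Definition lebesgue_row (n : nat) : set _ -> \bar R :=
  @completed_measure_extension _ _ _ (borel_lebesgue_row n).
HB.instance Definition _ n := Measure.on (@lebesgue_row n).

Definition lebesgue_spacetime (n : nat) : set _ -> \bar R :=
  @completed_measure_extension _ _ _
    (borel_lebesgue_row n \x @lebesgue_measure R)%E.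
HB.instance Definition _ n := Measure.on (@lebesgue_spacetime n).

Definition lebesgue_measurable_fun (n : nat) (f : 'rV[R]_n -> R) : Prop :=
  @measurable_fun _ _ (caratheodory_type (borel_lebesgue_row n)^*%mu) R setT f.

End lebesgue_row.
Arguments lebesgue_row : clear implicits.
Arguments lebesgue_spacetime : clear implicits.

Section smooth.
Context (R : realType) (V : normedModType R).

(* f is C^0 on the open set U if it is continuous there, and C^(k+1) if it is *)
(* differentiable there with all its directional derivatives of class C^k.    *)
Fixpoint Ck (k : nat) (U : set V) (f : V -> R) : Prop :=
  match k with
  | 0 => forall x, U x -> {for x, continuous f}
  | k'.+1 => (forall x, U x -> differentiable f x) /\
             forall v : V, Ck k' U ('D_v f)
  end.

(* On a set A which need not be open (such as R^N x [0, T[), a function is    *)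
(* C^oo if around each point of A it extends to a C^oo function on an open    *)
(* set; the values of f outside A play no role.                               *)
Definition smooth_on (A : set V) (f : V -> R) : Prop :=
  forall x, A x -> exists (U : set V) (g : V -> R),
    [/\ open U, U x, forall k, Ck k U g & forall y, A y -> U y -> f y = g y].

End smooth.

Definition critical_exponent (R : realType) (N m : nat) : R :=
  1 + (2 * m)%:R / N%:R.

Section cauchy_problem.
Context (R : realType) (N : nat).
Implicit Types (phi u : 'rV[R]_N * R -> R) (T : R).

Definition slab T : set ('rV[R]_N * R) := setT `*` `[0, T[.

Definition open_slab T : set ('rV[R]_N * R) := setT `*` `]0, T[.

Definition dt phi : 'rV[R]_N * R -> R := 'D_(0, 1) phi.

Definition laplacian phi : 'rV[R]_N * R -> R := fun z =>
  \sum_(i < N) 'D_(delta_mx 0 i, 0) ('D_(delta_mx 0 i, 0) phi) z.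

(* (- Delta)^m *)
Definition polyharmonic (m : nat) phi : 'rV[R]_N * R -> R :=
  iter m (fun psi z => - laplacian psi z) phi.

Definition locally_integrable_slab T u : Prop :=
  forall K, compact K -> K `<=` slab T ->
    (lebesgue_spacetime R N).-integrable K (EFin \o u).

Definition test_function T phi : Prop :=
  smooth_on (slab T) phi /\
  exists r e : R, [/\ 0 < r, 0 < e, e < T &
    closure [set z | slab T z /\ phi z != 0] `<=`
      eball (0 : 'rV[R]_N) r `*` `[0, T - e]].

(* The double integrals are taken over 0 < t < T, where the derivatives of    *)
(* phi do not depend on the values of phi outside R^N x [0, T[.               *)
Definition is_solution (m : nat) (p : R) (mu : 'rV[R]_N -> R) T u : Prop :=
  locally_integrable_slab T u /\
  forall phi, test_function T phi ->
    let initial := fun x => phi (x, 0) * mu x in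
    let linear := fun z => - u z * dt phi z + u z * polyharmonic m phi z in
    let source := fun z => `|u z| `^ p * phi z in
    [/\ (lebesgue_row R N).-integrable setT (EFin \o initial),
        (lebesgue_spacetime R N).-integrable (open_slab T) (EFin \o linear),
        (lebesgue_spacetime R N).-integrable (open_slab T) (EFin \o source) &
        - (\int[lebesgue_row R N]_x initial x) +
          \int[lebesgue_spacetime R N]_(z in open_slab T) linear z =
        \int[lebesgue_spacetime R N]_(z in open_slab T) source z].

End cauchy_problem.

(* Main.v *)
From HB Require Import structures.
Require Import Defs.
From mathcomp Require Import all_boot all_order all_algebra.
From mathcomp Require Import all_classical all_reals all_analysis.
From mathcomp Require Import measurable_realfun zify ring lra.
Import Order.TTheory GRing.Theory Num.Theory.
Import numFieldNormedType.Exports.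
Set Implicit Arguments.
Unset Strict Implicit.
Unset Printing Implicit Defensive.
Local Open Scope classical_set_scope.
Local Open Scope ring_scope.

(** A local solution forces a bound on the mass of [mu] near the origin, and the
    assumed lower bound on [mu] contradicts it once [gamma1] is large.

    Testing the equation with [phi >= 0] gives
      [int mu phi(.,0) = int (u L phi - |u|^p phi)],  [L = - d/dt + (-Delta)^m].
    If [|L phi| <= b phi^(1/p)], Young's inequality bounds the right-hand
    integrand pointwise by [b^(p/(p-1))], whatever [u] is ([young_absorption]).
    So everything rests on a good choice of [phi].

    The building block is [bump K], the [K]-th power of a smooth cutoff of
    [|x|^2 + t] that is 1 where this gauge is at most 1 and 0 where it is at
    least 2.  Each derivative costs one power of the cutoff, so for
    [K (1 - 1/p) >= 2m] the bound [|L bump| <= C bump^(1/p)] holds for [t >= 0]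
    ([adjoint_bump]).  The parabolic dilation [(x, t) |-> (2^j x, 2^(2mj) t)]
    multiplies [L] by [2^(2mj)], and [L] of the [j]-th dilated bump lives where
    the dilated gauge lies between 1 and 2; for [t >= 0] these regions are
    disjoint for distinct [j].

    For [p > p_m] a single dilated bump suffices: the mass of [mu] in the ball of
    radius [2^-j] is at most a constant times [2^(j (2m/(p-1) - N))], while
    [mu >= gamma1 |x|^(-2m/(p-1))] gives at least [gamma1] times a constant times
    the same power.

    For [p = p_m] that exponent vanishes and one scale no longer contradicts a
    logarithmically smaller [mu].  Here [phi] is a weighted sum of [n] consecutive
    dilated bumps ([multiscale]), a cutoff linear in the logarithm of the scale
    and then raised to the power [K]: it satisfies the same inequality with
    [b] of order [2^(2mj) / n] on the [j]-th region ([multiscale_test]), and the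
    [n] regions together contribute [n * n^(-p/(p-1)) = n^(-N/(2m))].  Over the
    next [n] dyadic shells the lower bound on [mu] integrates to [gamma1] times
    a constant times [n * n^(-N/(2m)-1)], which is the same power of [n]
    ([shell_mass_bound]). *)

(** * Smooth functions *)

Section smooth_calculus.
Context {R : realType} {V : normedModType R}.
Implicit Types (f g : V -> R) (v : V) (k : nat).

Definition smooth f := forall k, Ck k [set: V] f.

Lemma CkW k f : Ck k.+1 [set: V] f -> Ck k [set: V] f.
Proof.
elim: k f => [|k IH] f [df Df].
  by move=> x _; exact/differentiable_continuous/df.
by split=> // v; exact/IH/Df.
Qed.

Lemma smooth_differentiable f x : smooth f -> differentiable f x.
Proof. by move=> /(_ 1%N)[df _]; exact: df. Qed.

Lemma smooth_derivable f x v : smooth f -> derivable f x v.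
Proof. by move=> sf; exact/diff_derivable/smooth_differentiable. Qed.

Lemma smooth_continuous f : smooth f -> continuous f.
Proof. by move=> sf x; exact/differentiable_continuous/smooth_differentiable. Qed.

Lemma smooth_derive f v : smooth f -> smooth ('D_v f).
Proof. by move=> sf k; exact: (sf k.+1).2. Qed.

(** [Ck] is tested one order at a time; membership in a class of differentiable
    functions stable under directional derivatives yields all orders at once. *)
Lemma smooth_coind (P : (V -> R) -> Prop) :
  (forall f, P f -> (forall x, differentiable f x) /\ forall v, P ('D_v f)) ->
  forall f, P f -> smooth f.
Proof.
move=> HP f Pf k; elim: k f Pf => [|k IH] f Pf.
  by move=> x _; apply/differentiable_continuous/(HP _ Pf).1.
by split=> [x _|v]; [exact: (HP _ Pf).1|apply/IH/(HP _ Pf).2].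
Qed.

Lemma smooth_cst (a : R) : smooth (cst a).
Proof.
apply: (@smooth_coind (fun f => exists a : R, f = cst a)); last by exists a.
move=> _ [b ->]; split=> [x|v]; first exact: differentiable_cst.
by exists 0; apply/funext => x; rewrite derive_cst.
Qed.

Lemma CkD k f g : Ck k [set: V] f -> Ck k [set: V] g -> Ck k [set: V] (f \+ g).
Proof.
elim: k f g => [|k IH] f g.
  by move=> cf cg x _; apply: (@continuousD _ _ _ f g); [exact: cf|exact: cg].
move=> [df Df] [dg Dg]; split=> [x _|v].
  by apply: (@differentiableD _ _ _ f g); [exact: df|exact: dg].
have -> : 'D_v (f \+ g) = 'D_v f \+ 'D_v g.
  by apply/funext => x; rewrite (@deriveD _ _ _ f g)//;
    apply: diff_derivable; [exact: df|exact: dg].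
apply: IH; [exact: Df|exact: Dg].
Qed.

Lemma CkM k f g : Ck k [set: V] f -> Ck k [set: V] g -> Ck k [set: V] (f \* g).
Proof.
elim: k f g => [|k IH] f g.
  by move=> cf cg x _; apply: (@continuousM _ _ f g); [exact: cf|exact: cg].
move=> Cf Cg; have [[df Df] [dg Dg]] := (Cf, Cg); split=> [x _|v].
  by apply: (@differentiableM _ _ f g); [exact: df|exact: dg].
have -> : 'D_v (f \* g) = (f \* 'D_v g) \+ (g \* 'D_v f).
  by apply/funext => x; rewrite (@deriveM _ _ f g)//;
    apply: diff_derivable; [exact: df|exact: dg].
apply: CkD; apply: IH; try exact: CkW; [exact: Dg|exact: Df].
Qed.

Lemma smoothD f g : smooth f -> smooth g -> smooth (f \+ g).
Proof. by move=> sf sg k; exact: CkD. Qed.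

Lemma smoothM f g : smooth f -> smooth g -> smooth (f \* g).
Proof. by move=> sf sg k; exact: CkM. Qed.

Lemma smoothZ (a : R) f : smooth f -> smooth (fun x => a * f x).
Proof. by move=> sf; exact: (smoothM (smooth_cst a)). Qed.

Lemma smoothN f : smooth f -> smooth (fun x => - f x).
Proof.
move=> sf; under eq_fun do rewrite -mulN1r; exact: smoothZ.
Qed.

Lemma smoothX f n : smooth f -> smooth (fun x => f x ^+ n).
Proof.
move=> sf; elim: n => [|n IH].
  by rewrite (_ : (fun _ => _) = cst 1)//; exact: smooth_cst.
rewrite (_ : (fun _ => _) = f \* (fun x => f x ^+ n)); first exact: smoothM.
by apply/funext => x; rewrite exprS.
Qed.

Lemma smooth_sum (I : Type) (s : seq I) (F : I -> V -> R) :
  (forall i, smooth (F i)) -> smooth (fun x => \sum_(i <- s) F i x).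
Proof.
move=> sF; elim: s => [|i s IH].
  under eq_fun do rewrite big_nil; exact: smooth_cst.
under eq_fun do rewrite big_cons; exact: (smoothD (sF i)).
Qed.

Lemma derive_cmul (a : R) f v x : smooth f ->
  'D_v (fun y => a * f y) x = a * 'D_v f x.
Proof. by move=> sf; rewrite (@deriveZ _ _ _ f a)//; exact: smooth_derivable. Qed.

Lemma derive_add f g v x : smooth f -> smooth g ->
  'D_v (f \+ g) x = 'D_v f x + 'D_v g x.
Proof. by move=> sf sg; rewrite (@deriveD _ _ _ f g)//; exact: smooth_derivable. Qed.

Lemma derive_mul f g v x : smooth f -> smooth g ->
  'D_v (f \* g) x = f x * 'D_v g x + g x * 'D_v f x.
Proof. by move=> sf sg; rewrite (@deriveM _ _ f g)//; exact: smooth_derivable. Qed.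

Lemma derive_exp f n v x : smooth f ->
  'D_v (fun y => f y ^+ n.+1) x = n.+1%:R * f x ^+ n * 'D_v f x.
Proof.
move=> sf; have -> : (fun y => f y ^+ n.+1) = f ^+ n.+1.
  by apply/funext => y; rewrite exprfctE.
exact: (deriveX _ (smooth_derivable sf)).
Qed.

Lemma derive_open f g (U : set V) v : open U -> (forall x, U x -> f x = g x) ->
  forall x, U x -> 'D_v f x = 'D_v g x.
Proof.
move=> oU fg x Ux; apply: near_eq_derive.
by near=> y; apply: fg; near: y; exact: open_nbhs_nbhs.
Unshelve. all: by end_near. Qed.

Lemma derive_scale (a : R) f v x : smooth f -> 'D_(a *: v) f x = a * 'D_v f x.
Proof.
move=> sf; have df : differentiable f x := smooth_differentiable x sf.
by rewrite !deriveE// linearZ.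
Qed.

Section linear_change.
Variable A : {linear V -> V}.
Hypothesis cA : continuous A.

Lemma derive_linear_comp f v x : 'D_v (f \o A) x = 'D_(A v) f (A x).
Proof.
rewrite /derive.
set g1 := fun h => h^-1 *: _; set g2 := fun h => h^-1 *: _.
suff -> : g1 = g2 by [].
apply/funext => h; congr (_ *: (f _ - _)); exact: linearP.
Qed.

Lemma smooth_linear_comp f : smooth f -> smooth (f \o A).
Proof.
move=> sf; apply: (@smooth_coind (fun h => exists2 f, smooth f & h = f \o A));
  last by exists f.
move=> _ [g sg ->]; split=> [x|v].
  apply: differentiable_comp; last exact: smooth_differentiable.
  exact: linear_differentiable.
exists ('D_(A v) g); first exact: smooth_derive.
by apply/funext => x; rewrite derive_linear_comp.
Qed.

End linear_change.

Lemma smooth_linear (f : {linear V -> R}) : continuous f -> smooth f.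
Proof.
move=> cf [|k]; first by move=> x _; exact: cf.
split=> [x _|v]; first exact: linear_differentiable.
rewrite (_ : 'D_v f = cst (f v)); first exact: smooth_cst.
by apply/funext => x; rewrite deriveE ?diff_lin//; exact: linear_differentiable.
Qed.

(** Smoothness of the outer function is given by a class stable under derivative,
    which avoids the iterated chain rule: a derivative of [g \o f] is [g' \o f],
    with [g'] in the class, times a derivative of [f]. *)
Lemma smooth_comp (G : set (R -> R)) :
  (forall g : R -> R, G g -> (forall x, derivable g x 1) /\ G g^`()%classic) ->
  forall (g : R -> R) f, G g -> smooth f -> smooth (g \o f).
Proof.
move=> HG g f Gg sf k; elim: k g Gg => [|k IH] g Gg; have [dg Gg'] := HG _ Gg.
  move=> x _; apply: continuous_comp; first exact: smooth_continuous.
  exact/differentiable_continuous/derivable1_diffP.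
have dgx x : differentiable g x by exact/derivable1_diffP.
split=> [x _|v].
  by apply: differentiable_comp => //; exact: smooth_differentiable.
have -> : 'D_v (g \o f) = (g^`()%classic \o f) \* 'D_v f.
  apply/funext => x /=.
  have df : differentiable f x := smooth_differentiable x sf.
  rewrite deriveE; last exact: differentiable_comp.
  rewrite diff_comp// /= derive1E' // deriveE//.
  by rewrite -[X in 'd g _ X = _]mulr1 [LHS]linearZ/= mulrC.
by apply: CkM; [exact: IH|exact: smooth_derive].
Qed.

End smooth_calculus.

(** * A smooth cutoff *)

Section cutoff.
Context {R : realType}.
Implicit Types (P : {poly R}) (t s : R).

(** [P(1/t) e^(-1/t)], extended by 0: the polynomial factor makes the family
    stable under derivative. *)
Definition flat P t : R := if 0 < t then P.[t^-1] * expR (- t^-1) else 0.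

Lemma exp_dominates_power n (y : R) : 0 <= y -> y ^+ n * expR (- y) <= n`!%:R.
Proof.
move=> y0; rewrite expRN ler_pdivrMr ?expR_gt0//.
case: n => [|n]; first by rewrite expr0 fact0 mul1r (le_trans _ (expR_ge1Dx _))// lerDl.
rewrite mulrC -ler_pdivrMr ?ltr0n ?fact_gt0//.
by apply: (le_trans _ (expR_ge1Dxn n y0)); rewrite lerDr.
Qed.

(** Each monomial of [P] is absorbed by the exponential. *)
Lemma flat_bounded P : exists2 C, 0 < C & forall t, `|flat P t| <= C.
Proof.
exists (1 + \sum_(i < size P) `|P`_i| * i`!%:R).
  by rewrite ltr_pwDl// sumr_ge0// => i _; rewrite mulr_ge0.
move=> t; rewrite /flat; case: ifPn => [t0|_]; last first.
  by rewrite normr0 addr_ge0// sumr_ge0// => i _; rewrite mulr_ge0.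
rewrite horner_coef mulr_suml (le_trans (ler_norm_sum _ _ _))//.
rewrite (le_trans _ (_ : \sum_(i < size P) `|P`_i| * i`!%:R <= _))//; last by rewrite lerDr.
apply: ler_sum => i _; rewrite -mulrA normrM ler_wpM2l//.
have ti : 0 <= t^-1 by rewrite invr_ge0 ltW.
rewrite ger0_norm; first exact: exp_dominates_power.
by rewrite mulr_ge0 ?expR_ge0 ?exprn_ge0.
Qed.

(** Away from 0 this is the chain rule.  At 0 the difference quotient at [h > 0]
    is [h * flat ('X^2 * P) h], which tends to 0 since the second factor is
    bounded. *)
Lemma is_derive_flat P t : is_derive t 1 (flat P) (flat ('X^2 * (P - P^`())) t).
Proof.
have [t0|t0|<-] := ltgtP 0 t.
- pose g : R -> R := (horner P : R -> R) * (expR \o -%R).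
  have dg (y : R) : is_derive y (1 : R) g ((P^`().[y] - P.[y]) * expR (- y)).
    have dP := is_derive_poly P y.
    have dN : is_derive y 1 (-%R : R -> R) (-1) by apply: is_deriveNid.
    have dE : is_derive y 1 (expR \o -%R) (- expR (- y)).
      apply: DeriveDef; first by (apply/derivable1_diffP/differentiable_comp;
        apply/derivable1_diffP; exact: ex_derive).
      rewrite -derive1E (@derive1_comp _ -%R expR y); [|exact: ex_derive|exact: derivable_expR].
      by rewrite !derive1E !derive_val mulrN1.
    apply: is_derive_eq; rewrite /= /GRing.scale /=; ring.
  apply: (@near_eq_is_derive _ _ _ (g \o GRing.inv)).
    near=> s; rewrite /flat /g /= ifT//; near: s; exact: lt_nbhsr.
  have tn0 : t != 0 by rewrite gt_eqF.
  have di : derivable (GRing.inv : R -> R) t 1 by exact: derivableV.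
  apply: DeriveDef.
    apply/derivable1_diffP/differentiable_comp; exact/derivable1_diffP.
  rewrite -derive1E (@derive1_comp _ GRing.inv g)//.
  rewrite !derive1E (@derive_val _ _ _ _ _ _ _ (dg t^-1)) deriveV// derive_id /flat t0.
  rewrite !hornerE /= /GRing.scale /=; field.
  by [].
- rewrite [X in is_derive _ _ _ X](_ : _ = 0); last by rewrite /flat ltNge ltW.
  apply: (@near_eq_is_derive _ _ _ (cst 0)).
  near=> s; rewrite /flat ifF// lt_gtF//; near: s; exact: lt_nbhsl.
rewrite [X in is_derive _ _ _ X](_ : _ = 0); last by rewrite /flat ltxx.
have [C C0 HC] := flat_bounded ('X^2 * P).
have quot : (fun h : R => h^-1 *: ((flat P \o shift 0) (h *: 1) - flat P 0)) @ 0^' --> (0 : R).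
  apply/cvgrPdist_le => e e0; near=> h.
  rewrite /= addr0 [h%:A]mulr1 /flat ltxx subr0 sub0r normrN.
  case: ifPn => [h0|_]; last by rewrite scaler0 normr0 ltW.
  have := HC h; rewrite /flat h0 !hornerE => Ch.
  rewrite [X in `|X|](_ : _ = h * (h^-1 * h^-1 * P.[h^-1] * expR (- h^-1))); last first.
    by rewrite /GRing.scale /=; field; rewrite gt_eqF.
  rewrite normrM (le_trans (ler_wpM2l _ Ch))// -ler_pdivlMr//.
  near: h; apply: dnbhs0_le; exact: divr_gt0.
by apply: DeriveDef; [apply/cvg_ex; exists 0|apply/cvg_lim].
Unshelve. all: by end_near. Qed.

Lemma smooth_flat_comp (V : normedModType R) P (f : V -> R) :
  smooth f -> smooth (flat P \o f).
Proof.
apply: (@smooth_comp _ _ [set g | exists P, g = flat P]); last by exists P.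
move=> _ [Q ->]; split=> [x|]; first exact: (@ex_derive _ _ _ _ _ _ _ (is_derive_flat Q x)).
exists ('X^2 * (Q - Q^`())); apply/funext => x.
by rewrite derive1E (@derive_val _ _ _ _ _ _ _ (is_derive_flat Q x)).
Qed.

Let F := flat 1.

Let F_gt0E t : 0 < t -> F t = expR (- t^-1).
Proof. by move=> t0; rewrite /F /flat t0 -polyC1 hornerC mul1r. Qed.

Let F_le0 t : t <= 0 -> F t = 0.
Proof. by move=> t0; rewrite /F /flat ltNge t0. Qed.

Let F_ge0 t : 0 <= F t.
Proof. by have [/F_le0->|/F_gt0E->] := leP t 0; rewrite ?expR_ge0. Qed.

Let F_nd t s : t <= s -> F t <= F s.
Proof.
move=> ts; have [/F_le0->|t0] := leP t 0; first exact: F_ge0.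
have s0 := lt_le_trans t0 ts.
by rewrite !F_gt0E// ler_expR lerN2 lef_pV2.
Qed.

Let eF1 : expR 1 * F 1 = 1.
Proof. by rewrite F_gt0E// invr1 -expRD subrr expR0. Qed.

(** The inner expression is 1 for [s <= 1] and nonpositive for [2 <= s], since [F]
    is nondecreasing and [expR 1 * F 1 = 1].  Composing flat functions instead of
    dividing them leaves smoothness to the composition rule. *)
Definition cutoff s : R := expR 1 * F (1 - expR 1 * F (s - 1)).

Lemma cutoff_ge0 s : 0 <= cutoff s.
Proof. by rewrite mulr_ge0 ?expR_ge0. Qed.

Lemma cutoff_le1 s : cutoff s <= 1.
Proof.
by rewrite -[leRHS]eF1 ler_wpM2l ?expR_ge0 ?F_nd// gerBl mulr_ge0 ?expR_ge0.
Qed.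

Lemma cutoff_eq1 s : s <= 1 -> cutoff s = 1.
Proof. by move=> s1; rewrite /cutoff (F_le0 (t := s - 1)) ?subr_le0// mulr0 subr0. Qed.

Lemma cutoff_eq0 s : 2 <= s -> cutoff s = 0.
Proof.
move=> s2; rewrite /cutoff F_le0 ?mulr0// subr_le0 -[leLHS]eF1 ler_wpM2l ?expR_ge0//.
by apply: F_nd; lra.
Qed.

Lemma smooth_cutoff (V : normedModType R) (f : V -> R) :
  smooth f -> smooth (cutoff \o f).
Proof.
move=> sf; have -> : cutoff \o f = fun x =>
    expR 1 * (F \o (cst 1 \+ (fun x => (- expR 1) * (F \o (f \+ cst (-1))) x))) x.
  by apply/funext => x; rewrite /cutoff /= mulNr.
apply/smoothZ/smooth_flat_comp/smoothD; first exact: smooth_cst.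
apply/smoothZ/smooth_flat_comp/smoothD => //; exact: smooth_cst.
Qed.

End cutoff.

(** * The adjoint operator *)

Section adjoint.
Context {R : realType} {N : nat}.
Notation V := ('rV[R]_N * R)%type.
Implicit Types (f g h : V -> R) (v : V) (a b : R).

(** The formal adjoint of [d/dt + (-Delta)^m]. *)
Definition adjoint m f : V -> R := fun z => - dt f z + polyharmonic m f z.

Lemma polyharmonicS m f :
  polyharmonic m.+1 f = fun z => - laplacian (polyharmonic m f) z.
Proof. by []. Qed.

Lemma smooth_laplacian f : smooth f -> smooth (laplacian f).
Proof.
by move=> sf; apply: smooth_sum => i; do 2 apply: smooth_derive.
Qed.

Lemma smooth_polyharmonic m f : smooth f -> smooth (polyharmonic m f).
Proof.
by move=> sf; elim: m => //= m IH; exact/smoothN/smooth_laplacian.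
Qed.

Lemma derive_lin (I : Type) (r : seq I) (c : I -> R) (F : I -> V -> R) v z :
  (forall i, smooth (F i)) ->
  'D_v (fun z => \sum_(i <- r) c i * F i z) z = \sum_(i <- r) c i * 'D_v (F i) z.
Proof.
move=> sF; elim: r => [|i r IH].
  have -> : (fun z => \sum_(i <- [::]) c i * F i z) = cst 0.
    by apply/funext => w; rewrite big_nil.
  by rewrite derive_cst big_nil.
have -> : (fun z => \sum_(j <- i :: r) c j * F j z) = (fun z => c i * F i z) \+
    (fun z => \sum_(i <- r) c i * F i z).
  by apply/funext => w; rewrite big_cons.
rewrite derive_add ?derive_cmul ?IH ?big_cons//; first exact: smoothZ.
by apply: smooth_sum => j; exact: smoothZ.
Qed.

Lemma laplacian_lin (I : Type) (r : seq I) (c : I -> R) (F : I -> V -> R) :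
  (forall i, smooth (F i)) ->
  laplacian (fun z => \sum_(i <- r) c i * F i z) =
  fun z => \sum_(i <- r) c i * laplacian (F i) z.
Proof.
move=> sF; apply/funext => z; rewrite /laplacian.
transitivity (\sum_(i < N) \sum_(j <- r)
    c j * 'D_(delta_mx 0 i, 0) ('D_(delta_mx 0 i, 0) (F j)) z).
  apply: eq_bigr => i _.
  rewrite -derive_lin; last by move=> j; exact: smooth_derive.
  by congr (derive _ z _); apply/funext => w; rewrite derive_lin.
by rewrite exchange_big /=; apply: eq_bigr => i _; rewrite mulr_sumr.
Qed.

Lemma polyharmonic_lin m (I : Type) (r : seq I) (c : I -> R) (F : I -> V -> R) :
  (forall i, smooth (F i)) ->
  polyharmonic m (fun z => \sum_(i <- r) c i * F i z) =
  fun z => \sum_(i <- r) c i * polyharmonic m (F i) z.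
Proof.
move=> sF; elim: m => //= m ->; apply/funext => z.
rewrite laplacian_lin; last by move=> i; exact: smooth_polyharmonic.
by rewrite -sumrN; apply: eq_bigr => i _; rewrite mulrN.
Qed.

Lemma adjoint_lin m (I : Type) (r : seq I) (c : I -> R) (F : I -> V -> R) z :
  (forall i, smooth (F i)) ->
  adjoint m (fun z => \sum_(i <- r) c i * F i z) z =
  \sum_(i <- r) c i * adjoint m (F i) z.
Proof.
move=> sF; rewrite /adjoint polyharmonic_lin// /dt derive_lin//.
by rewrite -sumrN -big_split /=; apply: eq_bigr => i _; rewrite mulrDr mulrN.
Qed.

Lemma polyharmonic_open m f g (U : set V) : open U ->
  (forall z, U z -> f z = g z) ->
  forall z, U z -> polyharmonic m f z = polyharmonic m g z.
Proof.
move=> oU fg; elim: m => [|m IH] z Uz; first exact: fg.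
rewrite !polyharmonicS /laplacian; congr (- _); apply: eq_bigr => i _.
by apply: (derive_open _ oU) => // w Uw; apply: (derive_open _ oU).
Qed.

Lemma adjoint_locally_cst m f a (U : set V) : (0 < m)%N -> open U ->
  (forall z, U z -> f z = a) -> forall z, U z -> adjoint m f z = 0.
Proof.
move=> m0 oU fa z Uz; rewrite /adjoint /dt.
rewrite (@polyharmonic_open m f (cst a) U)//.
rewrite (@derive_open _ _ f (cst a) U)// derive_cst oppr0 add0r.
have lap0 b : laplacian (cst b : V -> R) = cst 0.
  apply/funext => w; apply: big1 => i _.
  rewrite (_ : 'D_(_, _) (cst b) = cst 0) ?derive_cst//.
  by apply/funext => y; rewrite derive_cst.
case: m m0 {fa} => // m _; suff [b E] : exists b, polyharmonic m (cst a : V -> R) = cst b.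
  by rewrite polyharmonicS E lap0 oppr0.
elim: m => [|m [b E]]; first by exists a.
by exists 0; rewrite polyharmonicS E lap0; apply/funext => y; rewrite oppr0.
Qed.

Definition dilation a b (z : V) : V := (a *: z.1, b *: z.2).

Fact dilation_linear a b : linear (dilation a b).
Proof.
move=> c [x s] [y t]; rewrite /dilation /=; congr pair.
  by rewrite scalerDr !scalerA mulrC -scalerA.
by rewrite scalerDr !scalerA mulrC -scalerA.
Qed.

HB.instance Definition _ a b :=
  GRing.isLinear.Build R V V *:%R (dilation a b) (dilation_linear a b).

Lemma dilation_space a b (i : 'I_N) :
  dilation a b (delta_mx 0 i, 0) = a *: (delta_mx 0 i, 0).
Proof. by apply: injective_projections; rewrite /= ?scaler0. Qed.

Lemma dilation_time a b : dilation a b (0, 1) = b *: (0, 1).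
Proof. by apply: injective_projections; rewrite /= ?scaler0. Qed.

Lemma dilation_continuous a b : continuous (dilation a b).
Proof.
move=> z; apply: (@cvg_pair _ _ _ (nbhs z) (nbhs (a *: z.1)) (nbhs (b *: z.2)) _ _ _
  (fun z => a *: z.1) (fun z => b *: z.2)).
  apply: cvgZl_tmp; exact: cvg_fst.
apply: cvgZl_tmp; exact: cvg_snd.
Qed.

Lemma smooth_dilation f a b : smooth f -> smooth (f \o dilation a b).
Proof. by apply: smooth_linear_comp; exact: dilation_continuous. Qed.

Lemma laplacian_dilation f a b : smooth f ->
  laplacian (f \o dilation a b) = fun z => a ^+ 2 * laplacian f (dilation a b z).
Proof.
move=> sf; apply/funext => z; rewrite /laplacian mulr_sumr; apply: eq_bigr => i _.
have E g w : smooth g -> 'D_(delta_mx 0 i, 0) (g \o dilation a b) w =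
    a * 'D_(delta_mx 0 i, 0) g (dilation a b w).
  by move=> sg; rewrite derive_linear_comp/= dilation_space derive_scale.
transitivity ('D_(delta_mx 0 i, 0) (fun w =>
    a * ('D_(delta_mx 0 i, 0) f \o dilation a b) w) z).
  by congr (derive _ z _); apply/funext => w; rewrite E.
rewrite derive_cmul; last exact/smooth_dilation/smooth_derive.
rewrite E; last exact: smooth_derive.
by rewrite expr2 mulrA.
Qed.

Lemma polyharmonic_dilation m f a b : smooth f ->
  polyharmonic m (f \o dilation a b) =
  fun z => a ^+ (2 * m) * polyharmonic m f (dilation a b z).
Proof.
move=> sf; elim: m => [|m IH]; first by apply/funext => z; rewrite mul1r.
rewrite [LHS]/= IH; apply/funext => z.
have -> : (fun z => a ^+ (2 * m) * polyharmonic m f (dilation a b z)) =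
    (fun z => \sum_(i <- [:: tt]) a ^+ (2 * m) * (polyharmonic m f \o dilation a b) z).
  by apply/funext => w; rewrite big_seq1.
rewrite laplacian_lin; last by move=> _; exact/smooth_dilation/smooth_polyharmonic.
rewrite big_seq1 laplacian_dilation; last exact: smooth_polyharmonic.
by rewrite /= mulnSr exprD mulrA mulrN.
Qed.

(** Scaling time by the [2m]-th power of the spatial factor makes both terms of
    the operator scale alike. *)
Lemma adjoint_dilation m f a z : smooth f ->
  adjoint m (f \o dilation a (a ^+ (2 * m))) z =
  a ^+ (2 * m) * adjoint m f (dilation a (a ^+ (2 * m)) z).
Proof.
move=> sf; rewrite /adjoint polyharmonic_dilation// mulrDr mulrN; congr (- _ + _).
rewrite /dt derive_linear_comp /=.
by rewrite dilation_time derive_scale.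
Qed.

(** Divisibility by [h ^ n] among smooth functions.  A derivative lowers [n] by at
    most one, which is all that the bound on [(-Delta)^m] of a power of [h] uses;
    the expansion of that derivative never appears. *)
Definition vanishes_to h n f := exists2 g, smooth g & f = fun z => h z ^+ n * g z.

Lemma vanishes_toW h n k f : smooth h -> vanishes_to h (n + k) f -> vanishes_to h n f.
Proof.
move=> sh [g sg ->]; exists ((fun z => h z ^+ k) \* g).
  by apply: smoothM => //; exact: smoothX.
by apply/funext => z /=; rewrite exprD mulrA.
Qed.

Lemma vanishes_toD h n f g : vanishes_to h n f -> vanishes_to h n g ->
  vanishes_to h n (fun z => f z + g z).
Proof.
move=> [f' sf ->] [g' sg ->]; exists (f' \+ g'); first exact: smoothD.
by apply/funext => z; rewrite /= mulrDr.
Qed.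

Lemma vanishes_toN h n f : vanishes_to h n f -> vanishes_to h n (fun z => - f z).
Proof.
move=> [g sg ->]; exists (fun z => - g z); first exact: smoothN.
by apply/funext => z; rewrite mulrN.
Qed.

Lemma vanishes_to_sum h n (I : Type) (r : seq I) (F : I -> V -> R) :
  (forall i, vanishes_to h n (F i)) ->
  vanishes_to h n (fun z => \sum_(i <- r) F i z).
Proof.
move=> hF; elim: r => [|i r IH].
  under eq_fun do rewrite big_nil.
  by exists (cst 0); [exact: smooth_cst|apply/funext => z; rewrite mulr0].
by under eq_fun do rewrite big_cons; exact: vanishes_toD.
Qed.

Lemma vanishes_to_derive h n f v : smooth h ->
  vanishes_to h n.+1 f -> vanishes_to h n ('D_v f).
Proof.
move=> sh [g sg ->].
exists (h \* 'D_v g \+ (fun z => n.+1%:R * (g \* 'D_v h) z)).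
  apply: smoothD; first by apply: smoothM => //; exact: smooth_derive.
  by apply: smoothZ; apply: smoothM => //; exact: smooth_derive.
apply/funext => z; rewrite (@derive_mul _ _ (fun z => h z ^+ n.+1) g)//; last exact: smoothX.
by rewrite derive_exp//= exprS; ring.
Qed.

Lemma vanishes_to_polyharmonic h n m f : smooth h ->
  vanishes_to h (n + 2 * m) f -> vanishes_to h n (polyharmonic m f).
Proof.
move=> sh; elim: m n => [|m IH] n vf; first by rewrite muln0 addn0 in vf.
have {}IH : vanishes_to h n.+2 (polyharmonic m f).
  by apply: IH; rewrite mulnS addnA addn2 in vf.
apply: vanishes_toN; apply: vanishes_to_sum => i.
by do 2 apply: vanishes_to_derive => //.
Qed.

Lemma vanishes_to_adjoint h n m f : smooth h -> (0 < m)%N ->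
  vanishes_to h (n + 2 * m) f -> vanishes_to h n (adjoint m f).
Proof.
move=> sh m0 vf; apply: vanishes_toD; last exact: vanishes_to_polyharmonic vf.
apply: vanishes_toN; apply: vanishes_to_derive => //.
case: m m0 vf => // m _; rewrite mulnS addnA addn2 addSnnS => vf.
exact: vanishes_toW vf.
Qed.

End adjoint.

(** * The parabolic bump *)

Section bump.
Context {R : realType} {N : nat}.
Notation V := ('rV[R]_N * R)%type.
Implicit Types (z : V).

(** A polynomial, so smooth on all of space-time; for [t >= 0], where the
    equation is tested, it controls both [|x|] and [t]. *)
Definition gauge z : R := \sum_(i < N) z.1 0 i ^+ 2 + z.2.

Fact coord_linear (i : 'I_N) : linear (fun z : V => z.1 0 i).
Proof. by move=> c x y; rewrite /= !mxE. Qed.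

Fact time_linear : linear (fun z : V => z.2).
Proof. by []. Qed.

Lemma smooth_coord (i : 'I_N) : smooth (fun z : V => z.1 0 i).
Proof.
pose L := GRing.isLinear.Build R V R *:%R _ (coord_linear i).
pose f : {linear V -> R} := HB.pack (fun z : V => z.1 0 i) L.
have -> : (fun z : V => z.1 0 i) = f by [].
apply: smooth_linear => z; apply: (continuous_comp (g := fun x : 'rV[R]_N => x 0 i)).
  exact: cvg_fst.
exact: coord_continuous.
Qed.

Lemma smooth_time : smooth (fun z : V => z.2).
Proof.
pose L := GRing.isLinear.Build R V R *:%R _ time_linear.
pose f : {linear V -> R} := HB.pack (fun z : V => z.2) L.
have -> : (fun z : V => z.2) = f by [].
apply: smooth_linear => z; exact: cvg_snd.
Qed.

Lemma smooth_gauge : smooth gauge.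
Proof.
apply: smoothD; last exact: smooth_time.
by apply: smooth_sum => i; apply: smoothX; exact: smooth_coord.
Qed.

Lemma gauge_open_lt1 : open [set z | gauge z < 1].
Proof.
apply: (open_comp (f := gauge) (D := [set x | x < 1])); last exact: open_lt.
by move=> z _; exact: (smooth_continuous smooth_gauge).
Qed.

Definition cube (I : interval R) : set 'rV[R]_N :=
  [set x : 'rV[R]_N | forall i, [set` I] (x 0 i)].

Definition box (r s : R) : set V := cube `[- r, r] `*` `[0, s].

Lemma box_compact r s : compact (box r s).
Proof.
apply: compact_setX; last exact: segment_compact.
by apply: (@rV_compact _ _ (fun=> `[- r, r]%classic)) => i; exact: segment_compact.
Qed.

Lemma gauge_le2_box z : 0 <= z.2 -> gauge z <= 2 -> box 2 2 z.
Proof.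
move=> t0 g2; have s0 : 0 <= \sum_(i < N) z.1 0 i ^+ 2.
  by apply: sumr_ge0 => i _; exact: sqr_ge0.
rewrite /gauge in g2; split => [i|]; rewrite /= in_itv /=; last by lra.
have : z.1 0 i ^+ 2 <= \sum_(i < N) z.1 0 i ^+ 2.
  by rewrite (bigD1 i)//= lerDl sumr_ge0// => j _; exact: sqr_ge0.
rewrite -ler_norml => xi; rewrite -(@ler_pXn2r _ 2)// ?nnegrE//.
rewrite real_normK ?num_real//; lra.
Qed.

Definition bump K z : R := cutoff (gauge z) ^+ K.

Lemma bump_ge0 K z : 0 <= bump K z.
Proof. by rewrite exprn_ge0// cutoff_ge0. Qed.

Lemma bump_le1 K z : bump K z <= 1.
Proof. by rewrite exprn_ile1// ?cutoff_ge0 ?cutoff_le1. Qed.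

Lemma bump_eq1 K z : gauge z <= 1 -> bump K z = 1.
Proof. by move=> g1; rewrite /bump cutoff_eq1// expr1n. Qed.

Lemma bump_eq0 K z : (0 < K)%N -> 2 <= gauge z -> bump K z = 0.
Proof. by move=> K0 g2; rewrite /bump cutoff_eq0// expr0n gtn_eqF. Qed.

Lemma smooth_bump K : smooth (bump K).
Proof.
by apply: (smoothX (f := cutoff \o gauge)); exact/smooth_cutoff/smooth_gauge.
Qed.

Lemma adjoint_bump_inner m K z : (0 < m)%N -> gauge z < 1 ->
  adjoint m (bump K) z = 0.
Proof.
move=> m0 g1; apply: (adjoint_locally_cst (a := 1) m0 gauge_open_lt1) => // w /=.
by move=> /ltW; exact: bump_eq1.
Qed.

(** [adjoint m] of the [K]-th power of the cutoff [h] is [h ^ (K - 2m)] times a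
    smooth function, bounded on the box that contains the support for [t >= 0].
    The hypothesis on [K] says [K - 2m >= K / p], so [h ^ (K - 2m) <= (h ^ K)^(1/p)]
    because [0 <= h <= 1]. *)
Lemma adjoint_bump m (K : nat) (p : R) : (0 < m)%N -> 1 < p ->
  (2 * m)%:R <= K%:R * (1 - p^-1) ->
  exists2 C : R, 0 < C & forall z, 0 <= z.2 ->
    `|adjoint m (bump K) z| <= C * bump K z `^ p^-1.
Proof.
move=> m0 p1 HK.
have p0 : 0 < p by apply: lt_trans p1.
have q0 : 0 < 1 - p^-1 by rewrite subr_gt0 invf_lt1.
have mR : 2 <= (2 * m)%:R :> R by rewrite ler_nat leq_pmulr.
have KR : (2 * m)%:R + K%:R * p^-1 <= K%:R :> R by lra.
have K0 : (0 < K)%N by case: K HK KR => // /[!mul0r]; lra.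
have Kp : 0 < K%:R * p^-1 :> R by rewrite mulr_gt0 ?ltr0n ?invr_gt0.
have mK : (2 * m <= K)%N by rewrite -(ler_nat R); lra.
have [g sg Hg] : vanishes_to (cutoff \o gauge) (K - 2 * m) (adjoint m (bump K)).
  apply: vanishes_to_adjoint => //; first exact/smooth_cutoff/smooth_gauge.
  rewrite subnK//; exists (cst 1); first exact: smooth_cst.
  by apply/funext => z; rewrite mulr1.
have [c _ Hc] : exists2 c, c \in box 2 2 & forall z, z \in box 2 2 -> `|g z| <= `|g c|.
  apply: (@compact_EVT_max _ _ (fun z => `|g z|)).
  - by exists (0, 0); split => /= [i|]; rewrite /= ?mxE in_itv /=; lra.
  - exact: box_compact.
  - apply: continuous_subspaceT => z.
    by apply: cvg_norm; exact: (smooth_continuous sg).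
exists (1 + `|g c|); first by rewrite ltr_pwDl.
move=> z t0; rewrite Hg /=.
have [g2|/ltW g2] := leP 2 (gauge z).
  rewrite cutoff_eq0// expr0n subn_eq0 (ltn_geF _) ?mul0r ?normr0.
    by rewrite mulr_ge0// ?powR_ge0.
  by rewrite -(ltr_nat R); lra.
have gz : `|g z| <= 1 + `|g c|.
  by rewrite (le_trans (Hc z _)) ?inE ?lerDr//; exact: gauge_le2_box.
rewrite normrM mulrC ler_pM// /bump.
have := cutoff_ge0 (gauge z); rewrite le_eqVlt => /predU1P[<-|c0].
  rewrite normrX normr0 expr0n subn_eq0 (ltn_geF _) ?powR_ge0//.
  by rewrite -(ltr_nat R); lra.
rewrite ger0_norm ?exprn_ge0 ?cutoff_ge0// -!powR_mulrn ?cutoff_ge0// -powRrM.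
apply: ger_powR; first by rewrite c0 cutoff_le1.
by rewrite natrB//; lra.
Qed.

End bump.

(** * The multi-scale test function *)

(** Young's inequality for [a f^(1/p)] and [b]: the first factor, raised to the
    power [p], is exactly the term that is subtracted, so [f] disappears from the
    bound. *)
Lemma young_absorption {R : realType} (a b f p : R) :
  0 <= a -> 0 <= b -> 0 <= f -> 1 < p ->
  a * (b * f `^ p^-1) - a `^ p * f <= b `^ (p / (p - 1)).
Proof.
move=> a0 b0 f0 p1; set q := p / (p - 1).
have p0 : 0 < p by apply: lt_trans p1.
have q1 : 1 <= q by rewrite ler_pdivlMr ?subr_gt0// mul1r gerBl.
have q0 : 0 < q by apply: lt_le_trans q1.
have pq : p^-1 + q^-1 = 1 by rewrite /q; field; rewrite !gt_eqF ?subr_gt0.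
have A0 : 0 <= a * f `^ p^-1 by rewrite mulr_ge0 ?powR_ge0.
rewrite mulrCA [leLHS](_ : _ = (a * f `^ p^-1) * b - (a * f `^ p^-1) `^ p); last first.
  by rewrite powRM ?powR_ge0// -powRrM mulVf ?gt_eqF// powRr1//; ring.
have := conjugate_powR A0 b0 p0 q0 pq.
have : (a * f `^ p^-1) `^ p / p <= (a * f `^ p^-1) `^ p.
  by rewrite ler_pdivrMr// ler_peMr ?powR_ge0// ltW.
have : b `^ q / q <= b `^ q by rewrite ler_pdivrMr// ler_peMr ?powR_ge0.
lra.
Qed.

(** The mean value bound [K (x - y) x^(K-1)], together with
    [x^(K-1) <= x^(K/p)] for [x <= 1]. *)
Lemma power_increment {R : realType} (x y p : R) (K : nat) :
  0 <= y -> y <= x -> 0 < x -> x <= 1 -> 1 <= K%:R * (1 - p^-1) ->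
  x ^+ K - y ^+ K <= K%:R * (x - y) * (x ^+ K) `^ p^-1.
Proof.
move=> y0 yx x0 x1 HK.
rewrite subrXX mulrC [_%:R * _]mulrC -mulrA [leRHS]mulrC ler_wpM2r ?subr_ge0//.
have sumle : \sum_(i < K) x ^+ (K.-1 - i) * y ^+ i <= K%:R * x ^+ K.-1.
  rewrite -[K in K%:R]card_ord -sumr_const mulr_suml; apply: ler_sum => i _.
  rewrite mul1r -[leRHS](_ : x ^+ (K.-1 - i) * x ^+ i = _); last first.
    by rewrite -exprD subnK// -ltnS (leq_trans (ltn_ord i))// leqSpred.
  by rewrite ler_wpM2l ?exprn_ge0 ?(ltW x0)//; apply: lerXn2r; rewrite ?nnegrE// ltW.
apply: (le_trans sumle); rewrite ler_wpM2l//.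
have K0 : (0 < K)%N by case: K HK {sumle} => // /[!mul0r]; lra.
have KR : K.-1%:R = K%:R - 1 :> R by rewrite -subn1 natrB.
rewrite -!powR_mulrn ?(ltW x0)// -powRrM KR; apply: ger_powR; first by rewrite x0.
by move: HK; rewrite mulrBr mulr1; lra.
Qed.

Lemma nested_sum {R : realType} (n : nat) (w f : nat -> R) (l : 'I_n) :
  (forall i, 0 <= w i) -> (forall i, 0 <= f i) ->
  (forall i, (i <= l)%N -> f l <= f i) ->
  (\sum_(i < l.+1) w i) * f l <= \sum_(i < n) w i * f i.
Proof.
move=> w0 f0 fl; rewrite mulr_suml (big_ord_widen n (fun i => w i * f l) (ltn_ord l)).
rewrite big_mkcond /=; apply: ler_sum => i _; case: ifPn => il; last first.
  by rewrite mulr_ge0.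
by rewrite ler_wpM2l// fl// -ltnS.
Qed.

Section multiscale.
Context {R : realType} {N : nat}.
Notation V := ('rV[R]_N * R)%type.
Variables (m K : nat).
Hypotheses (m0 : (0 < m)%N) (K0 : (0 < K)%N).
Implicit Types (z : V) (i j l n : nat).

Definition dyadic j : V -> V := dilation (2 ^+ j) ((2 ^+ j) ^+ (2 * m)).

Definition dyadic_bump j z : R := bump K (dyadic j z).

Lemma smooth_dyadic_bump j : smooth (dyadic_bump j).
Proof. by apply: (smooth_dilation (f := bump K)); exact: smooth_bump. Qed.

Lemma adjoint_dyadic_bump j z :
  adjoint m (dyadic_bump j) z = (2 ^+ j) ^+ (2 * m) * adjoint m (bump K) (dyadic j z).
Proof. by rewrite -adjoint_dilation//; exact: smooth_bump. Qed.

Lemma gauge_dyadic j z : gauge (dyadic j z) =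
  (2 ^+ j) ^+ 2 * (\sum_(i < N) z.1 0 i ^+ 2) + (2 ^+ j) ^+ (2 * m) * z.2.
Proof.
rewrite /gauge /= mulr_sumr; congr (_ + _); apply: eq_bigr => i _.
by rewrite !mxE exprMn.
Qed.

Lemma gauge_dyadic_ge0 j z : 0 <= z.2 -> 0 <= gauge (dyadic j z).
Proof.
move=> t0; rewrite gauge_dyadic addr_ge0 ?mulr_ge0 ?exprn_ge0//.
by apply: sumr_ge0 => i _; exact: sqr_ge0.
Qed.

(** The factor 4 exceeds the ratio 2 of the outer to the inner threshold of the
    bump.  So for [t >= 0] the transition regions of distinct dyadic bumps are
    disjoint, and a bump equals 1 on the support of every finer one. *)
Lemma gauge_dyadic_lt i j z : (i < j)%N -> 0 <= z.2 ->
  4 * gauge (dyadic i z) <= gauge (dyadic j z).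
Proof.
move=> ij t0; have ij1 : 2 * 2 ^+ i <= 2 ^+ j :> R.
  by rewrite -exprS ler_eXn2l// ltr1n.
have p0 : 0 <= 2 * 2 ^+ i :> R by rewrite mulr_ge0// exprn_ge0.
have e k : (2 * 2 ^+ i) ^+ k <= (2 ^+ j) ^+ k :> R by apply: lerXn2r; rewrite ?nnegrE ?exprn_ge0.
rewrite !gauge_dyadic mulrDr (mulrA 4 ((2 ^+ i) ^+ 2)).
rewrite (mulrA 4 ((2 ^+ i) ^+ (2 * m))) lerD//; apply: ler_wpM2r => //.
- by apply: sumr_ge0 => k _; exact: sqr_ge0.
- by apply: (le_trans _ (e 2%N)); rewrite exprMn ler_wpM2r ?exprn_ge0// -natrX.
- apply: (le_trans _ (e (2 * m)%N)); rewrite exprMn ler_wpM2r ?exprn_ge0//.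
  by rewrite -natrX ler_nat (leq_exp2l 2 (2 * m) (ltnSn 1)) leq_pmulr.
Qed.

(** Increments of [(l/n)^K].  Equal weights [1/n] would make the sum too small
    near its outer edge when [p <= 2]; with the power [K], [adjoint m] of the sum
    decays there at least as fast as the [1/p]-th power of the sum. *)
Definition weight n l : R := (l.+1%:R / n%:R) ^+ K - (l%:R / n%:R) ^+ K.

Lemma weight_ge0 n l : 0 <= weight n l.
Proof.
rewrite subr_ge0; apply: lerXn2r; rewrite ?nnegrE ?divr_ge0// ler_wpM2r ?invr_ge0//.
by rewrite ler_nat.
Qed.

Lemma sum_weight n l : \sum_(i < l) weight n i = (l%:R / n%:R) ^+ K.
Proof.
rewrite -(big_mkord xpredT (weight n)) /weight telescope_sumr// mul0r expr0n.
by rewrite gtn_eqF// subr0.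
Qed.

Definition multiscale j0 n z : R :=
  \sum_(l < n) weight n l * dyadic_bump (j0 + l.+1) z.

Lemma smooth_multiscale j0 n : smooth (multiscale j0 n).
Proof. by apply: smooth_sum => l; apply: smoothZ; exact: smooth_dyadic_bump. Qed.

Lemma multiscale_ge0 j0 n z : 0 <= multiscale j0 n z.
Proof. by apply: sumr_ge0 => l _; rewrite mulr_ge0 ?weight_ge0 ?bump_ge0. Qed.

Lemma multiscale_eq1 j0 n z : (0 < n)%N -> 0 <= z.2 ->
  gauge (dyadic (j0 + n) z) <= 1 -> multiscale j0 n z = 1.
Proof.
move=> n0 t0 g1.
transitivity (\sum_(l < n) weight n l); last first.
  by rewrite sum_weight divff ?expr1n// pnatr_eq0 -lt0n.
apply: eq_bigr => l _; rewrite /dyadic_bump bump_eq1 ?mulr1//.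
have := ltn_ord l; rewrite leq_eqVlt => /predU1P[-> //|ln].
have jl : (j0 + l.+1 < j0 + n)%N by rewrite ltn_add2l.
have := gauge_dyadic_lt jl t0; have := gauge_dyadic_ge0 (j0 + l.+1) t0; lra.
Qed.

Lemma multiscale_eq0 j0 n z : 0 <= z.2 ->
  2 <= gauge (dyadic j0.+1 z) -> multiscale j0 n z = 0.
Proof.
move=> t0 g2; apply: big1 => l _; rewrite /dyadic_bump bump_eq0 ?mulr0//.
apply: (le_trans g2).
have := gauge_dyadic_ge0 j0.+1 t0.
case: l => -[|l] /= _; first by rewrite addn1.
have jl : (j0.+1 < j0 + l.+2)%N by rewrite !addnS !ltnS leq_addr.
by have := gauge_dyadic_lt jl t0; lra.
Qed.

Lemma dyadic_bump_nested i j z : (i <= j)%N -> 0 <= z.2 ->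
  dyadic_bump j z <= dyadic_bump i z.
Proof.
rewrite leq_eqVlt => /predU1P[-> //|ij] t0.
have [g2|g2] := leP 2 (gauge (dyadic j z)).
  by rewrite /dyadic_bump (bump_eq0 K0 g2) bump_ge0.
rewrite [leRHS]bump_eq1; first exact: bump_le1.
have := gauge_dyadic_lt ij t0; have := gauge_dyadic_ge0 i t0; lra.
Qed.

(** Coarser bumps dominate finer ones, so the first [l+1] terms alone give the
    total of their weights times the [l]-th bump. *)
Lemma multiscale_ge j0 n z (l : 'I_n) : 0 <= z.2 ->
  (l.+1%:R / n%:R) ^+ K * dyadic_bump (j0 + l.+1) z <= multiscale j0 n z.
Proof.
move=> t0; rewrite -sum_weight.
apply: (nested_sum (f := fun i => dyadic_bump (j0 + i.+1) z)) => [i|i|i il].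
- exact: weight_ge0.
- exact: bump_ge0.
- by apply: dyadic_bump_nested; rewrite // leq_add2l ltnS.
Qed.

Definition dyadic_box j : set V := box (2 / 2 ^+ j) (2 / (2 ^+ j) ^+ (2 * m)).

Lemma gauge_dyadic_box j z : 0 <= z.2 -> gauge (dyadic j z) <= 2 -> dyadic_box j z.
Proof.
move=> t0 g2; have [|/= H1 H2] := @gauge_le2_box _ _ (dyadic j z) _ g2.
  by rewrite /= mulr_ge0 ?exprn_ge0.
have pos k : 0 < (2 ^+ j) ^+ k :> R by rewrite !exprn_gt0.
split => [i|]; last first.
  by move: H2; rewrite /= !in_itv /= t0 ler_pdivlMr// mulrC => /andP[].
have := H1 i; rewrite /= !in_itv /= !mxE ler_pdivlMr ?exprn_gt0//.
by rewrite -mulNr ler_pdivrMr ?exprn_gt0// ![_ * z.1 _ _]mulrC.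
Qed.

Variables (p C : R).
Hypotheses (p1 : 1 < p) (HK : 1 <= K%:R * (1 - p^-1)) (C0 : 0 < C).
Hypothesis HC : forall z : V, 0 <= z.2 ->
  `|adjoint m (bump K) z| <= C * bump K z `^ p^-1.

(** At each point at most one bump is in transition, say the [l]-th.  Its weight is
    at most [K/n] times the [1/p]-th power of the partial sum of weights, and that
    sum times the bump is at most the whole sum [phi]; hence [|adjoint m phi|] is bounded by
    [phi^(1/p)] times a constant of order [2^(2mj)/n], and [young_absorption]
    applies with this constant. *)
Lemma multiscale_test j0 n z (u : R) : 0 <= z.2 ->
  u * adjoint m (multiscale j0 n) z - `|u| `^ p * multiscale j0 n z <=
  \sum_(l < n) (C * K%:R / n%:R * (2 ^+ (j0 + l.+1)) ^+ (2 * m)) `^ (p / (p - 1)) *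
    \1_(dyadic_box (j0 + l.+1)) z.
Proof.
move=> t0.
have p0 : 0 < p by apply: lt_trans p1.
have term0 (l : 'I_n) : 0 <=
    (C * K%:R / n%:R * (2 ^+ (j0 + l.+1)) ^+ (2 * m)) `^ (p / (p - 1)) *
    \1_(dyadic_box (j0 + l.+1)) z by rewrite mulr_ge0 ?powR_ge0.
have adjE : adjoint m (multiscale j0 n) z =
    \sum_(l < n) weight n l * adjoint m (dyadic_bump (j0 + l.+1)) z.
  apply: (@adjoint_lin _ _ m _ _ (fun l : 'I_n => weight n l)
    (fun l : 'I_n => dyadic_bump (j0 + l.+1))) => l; exact: smooth_dyadic_bump.
have outer j : 2 <= gauge (dyadic j z) -> adjoint m (dyadic_bump j) z = 0.
  move=> g2; rewrite adjoint_dyadic_bump.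
  have := @HC (dyadic j z); rewrite bump_eq0// powR0 ?invr_eq0 ?gt_eqF// mulr0.
  by rewrite normr_le0 /= => /(_ _)/eqP ->; rewrite ?mulr0// mulr_ge0 ?exprn_ge0.
have inner j : gauge (dyadic j z) < 1 -> adjoint m (dyadic_bump j) z = 0.
  by move=> g1; rewrite adjoint_dyadic_bump adjoint_bump_inner// mulr0.
have [[l0 /andP[lo hi]]|none] := pselect (exists l : 'I_n,
    1 <= gauge (dyadic (j0 + l.+1) z) < 2); last first.
  rewrite adjE big1 ?mulr0 ?sub0r => [|l _].
    rewrite (@le_trans _ _ 0)//; last by apply: sumr_ge0 => l _; exact: term0.
    by rewrite oppr_le0 mulr_ge0 ?powR_ge0 ?multiscale_ge0.
  have [g1|g1] := ltP (gauge (dyadic (j0 + l.+1) z)) 1; first by rewrite inner ?mulr0.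
  have [g2|g2] := leP 2 (gauge (dyadic (j0 + l.+1) z)); first by rewrite outer ?mulr0.
  by exfalso; apply: none; exists l; rewrite g1.
rewrite adjE (bigD1 l0)//= big1 ?addr0 => [|l ll0]; last first.
  have [ll|ll|/val_inj/eqP] := ltngtP l l0; last by rewrite (negPf ll0).
  - have jl : (j0 + l.+1 < j0 + l0.+1)%N by rewrite ltn_add2l.
    by rewrite inner ?mulr0//; have := gauge_dyadic_lt jl t0; lra.
  - have jl : (j0 + l0.+1 < j0 + l.+1)%N by rewrite ltn_add2l.
    by rewrite outer ?mulr0//; have := gauge_dyadic_lt jl t0; lra.
rewrite (bigD1 l0)//= -[leLHS]addr0 lerD//; last by apply: sumr_ge0 => l _; exact: term0.
rewrite indicE mem_set ?mulr1; last exact: gauge_dyadic_box (ltW hi).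
set lam := (2 ^+ _) ^+ _; pose x : R := l0.+1%:R / n%:R; set f := multiscale j0 n z.
have n0 : (0 < n)%N by apply: leq_ltn_trans (ltn_ord l0).
have lam0 : 0 <= lam by rewrite !exprn_ge0.
have b0 : 0 <= C * K%:R / n%:R * lam by rewrite mulr_ge0 ?divr_ge0 ?mulr_ge0// ltW.
have f0 : 0 <= f := multiscale_ge0 j0 n z.
have wle : weight n l0 <= K%:R / n%:R * (x ^+ K) `^ p^-1.
  have := @power_increment _ x (l0%:R / n%:R) p K; rewrite -mulrBl -natrB// subSnn mul1r.
  apply=> //.
  - by rewrite ler_wpM2r ?invr_ge0// ler_nat.
  - by rewrite divr_gt0 ?ltr0n.
  - by rewrite ler_pdivrMr ?ltr0n// mul1r ler_nat.
have key : `|weight n l0 * adjoint m (dyadic_bump (j0 + l0.+1)) z| <=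
    C * K%:R / n%:R * lam * f `^ p^-1.
  rewrite normrM (ger0_norm (weight_ge0 _ _)) adjoint_dyadic_bump -/lam.
  rewrite normrM (ger0_norm lam0).
  have d0 : 0 <= (dyadic (j0 + l0.+1) z).2 by rewrite /= mulr_ge0.
  have bf : (x ^+ K) `^ p^-1 * bump K (dyadic (j0 + l0.+1) z) `^ p^-1 <= f `^ p^-1.
    rewrite -powRM ?bump_ge0 ?exprn_ge0 ?divr_ge0//.
    apply: ge0_ler_powR; rewrite ?nnegrE ?invr_ge0 ?(ltW p0)//.
      by rewrite mulr_ge0 ?bump_ge0 ?exprn_ge0 ?divr_ge0.
    exact: multiscale_ge.
  apply: (@le_trans _ _ (K%:R / n%:R * (x ^+ K) `^ p^-1 *
      (lam * (C * bump K (dyadic (j0 + l0.+1) z) `^ p^-1)))).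
    by rewrite ler_pM ?weight_ge0 ?mulr_ge0// ler_wpM2l// HC.
  rewrite [leLHS](_ : _ = C * K%:R / n%:R * lam *
      ((x ^+ K) `^ p^-1 * bump K (dyadic (j0 + l0.+1) z) `^ p^-1)); last by ring.
  by rewrite ler_wpM2l.
apply: (le_trans _ (young_absorption (normr_ge0 u) b0 f0 p1)).
rewrite lerD2r (le_trans (ler_norm _))// normrM ler_wpM2l//.
Qed.

End multiscale.

(** * Integrals against step functions *)

Section step_function.
Context d (T : measurableType d) (R : realType).
Variables (mu : {measure set T -> \bar R}) (D : set T).
Hypothesis mD : measurable D.
Variables (n : nat) (A : 'I_n -> set T) (c v : 'I_n -> R).
Hypotheses (mA : forall i, measurable (A i)) (muA : forall i, mu (A i) = (v i)%:E).

Let step z := \sum_(i < n) c i * \1_(A i) z.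

Let integrable_piece i : mu.-integrable D (fun z => (c i * \1_(A i) z)%:E).
Proof.
have -> : (fun z => (c i * \1_(A i) z)%:E) = (fun z => ((c i)%:E * (\1_(A i) z)%:E)%E).
  by apply/funext => z; rewrite EFinM.
apply: integrableZl => //; apply/integrableP; split; first exact/measurable_EFinP.
rewrite (eq_integral (fun z => (\1_(A i) z)%:E)); last first.
  by move=> z _; rewrite gee0_abs// lee_fin.
rewrite integral_indic//; apply: (@le_lt_trans _ _ (mu (A i))).
  by apply: le_measure; rewrite ?inE//; exact: measurableI.
by rewrite muA ltry.
Qed.

Let stepE z : (step z)%:E = (\sum_(i < n) (c i * \1_(A i) z)%:E)%E.
Proof. by rewrite /step -sumEFin. Qed.

Lemma integrable_step : mu.-integrable D (EFin \o step).
Proof.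
have -> : EFin \o step = (fun z => \sum_(i < n) (c i * \1_(A i) z)%:E)%E.
  by apply/funext => z; rewrite -stepE.
by apply: integrable_sum => // i _.
Qed.

Lemma Rintegral_step :
  \int[mu]_(z in D) step z = \sum_(i < n) c i * fine (mu (A i `&` D)).
Proof.
rewrite /Rintegral; under eq_integral do rewrite stepE.
rewrite integral_sum//.
rewrite (eq_bigr (fun i => (c i * fine (mu (A i `&` D)))%:E)) ?sumEFin// => i _.
under eq_integral do rewrite EFinM.
have fA : mu (A i `&` D) \is a fin_num.
  rewrite ge0_fin_numE//; apply: (@le_lt_trans _ _ (mu (A i))).
    by apply: le_measure; rewrite ?inE//; exact: measurableI.
  by rewrite muA ltry.
rewrite integralZl//; first by rewrite integral_indic// EFinM fineK.
apply/integrableP; split; first exact/measurable_EFinP.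
rewrite (eq_integral (fun z => (\1_(A i) z)%:E)); last first.
  by move=> z _; rewrite gee0_abs// lee_fin.
by rewrite integral_indic// -ge0_fin_numE.
Qed.

End step_function.

Section step_bounds.
Context d (T : measurableType d) (R : realType).
Variables (mu : {measure set T -> \bar R}).

Lemma Rintegral_le_step (D : set T) (mD : measurable D) (n : nat)
    (A : 'I_n -> set T) (c v : 'I_n -> R) (f : T -> R) :
  (forall i, measurable (A i)) -> (forall i, mu (A i) = (v i)%:E) ->
  (forall i, 0 <= c i) -> mu.-integrable D (EFin \o f) ->
  (forall z, D z -> f z <= \sum_(i < n) c i * \1_(A i) z) ->
  \int[mu]_(z in D) f z <= \sum_(i < n) c i * v i.
Proof.
move=> mA muA c0 intf fle.
have intS := integrable_step mD c mA muA.
apply: (@le_trans _ _ (\int[mu]_(z in D) (\sum_(i < n) c i * \1_(A i) z))).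
  rewrite /Rintegral fine_le//; first exact: integrable_fin_num.
    exact: integrable_fin_num.
  by apply: le_integral => // z; rewrite inE lee_fin => /fle.
rewrite (Rintegral_step mD c mA muA); apply: ler_sum => i _; rewrite ler_wpM2l//.
rewrite -[leRHS]/(fine (v i)%:E) -muA fine_le ?muA//.
  rewrite ge0_fin_numE//; apply: (@le_lt_trans _ _ (mu (A i))).
    by apply: le_measure; rewrite ?inE//; exact: measurableI.
  by rewrite muA ltry.
by rewrite -muA; apply: le_measure; rewrite ?inE//; exact: measurableI.
Qed.

Lemma Rintegral_ge_step (n : nat) (A : 'I_n -> set T) (c v : 'I_n -> R) (f : T -> R) :
  (forall i, measurable (A i)) -> (forall i, mu (A i) = (v i)%:E) ->
  mu.-integrable setT (EFin \o f) ->
  (forall z, \sum_(i < n) c i * \1_(A i) z <= f z) ->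
  \sum_(i < n) c i * v i <= \int[mu]_z f z.
Proof.
move=> mA muA intf fle.
have intS := integrable_step measurableT c mA muA.
have <- : \int[mu]_z (\sum_(i < n) c i * \1_(A i) z) = \sum_(i < n) c i * v i.
  rewrite (Rintegral_step measurableT c mA muA).
  by apply: eq_bigr => i _; rewrite setIT muA.
rewrite /Rintegral fine_le//; [exact: integrable_fin_num..|].
by apply: le_integral => // z _; rewrite lee_fin fle.
Qed.

End step_bounds.

(** * Boxes *)

Section boxes.
Context {R : realType} {N : nat}.
Lemma measurable_cube (I : interval R) : measurable (cube I : set 'rV[R]_N).
Proof.
have -> : cube I = \big[setI/setT]_(i < N) [set x : 'rV[R]_N | [set` I] (x 0 i)].
  rewrite -bigcap_seq/=; apply/seteqP; split=> x /= H i; first by move=> _; exact: H.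
  by apply: H => //=; rewrite mem_index_enum.
apply: bigsetI_measurable => i _; rewrite -[X in measurable X]setTI.
by apply: measurable_coord => //; exact: measurable_itv.
Qed.

Lemma borel_lebesgue_row_cube (I : interval R) (r : R) :
  lebesgue_measure [set` I] = r%:E -> borel_lebesgue_row R N (cube I) = (r ^+ N)%:E.
Proof.
move=> mI; rewrite /cube (@borel_lebesgue_row_box R N (fun=> [set` I])).
  under eq_bigr do rewrite mI.
  by rewrite prodEFin prodr_const card_ord.
by move=> i; exact: measurable_itv.
Qed.

Lemma measurable_lebesgue_row (A : set 'rV[R]_N) : measurable A ->
  @measurable _ (caratheodory_type (borel_lebesgue_row R N)^*%mu) A.
Proof. exact: caratheodory_measurable_mu_ext. Qed.

Lemma lebesgue_row_cube (I : interval R) (r : R) :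
  lebesgue_measure [set` I] = r%:E -> lebesgue_row R N (cube I) = (r ^+ N)%:E.
Proof.
move=> mI; rewrite -(borel_lebesgue_row_cube mI).
apply: measurable_mu_extE; exact: measurable_cube.
Qed.

Lemma measurable_lebesgue_spacetime (A : set ('rV[R]_N * R)) : measurable A ->
  @measurable _ (caratheodory_type
    (borel_lebesgue_row R N \x @lebesgue_measure R)%E^*%mu) A.
Proof.
exact: (@caratheodory_measurable_mu_ext _ R _
  (borel_lebesgue_row R N \x @lebesgue_measure R)%E A).
Qed.

Lemma lebesgue_spacetime_cube (I J : interval R) (r s : R) :
  lebesgue_measure [set` I] = r%:E -> lebesgue_measure [set` J] = s%:E ->
  lebesgue_spacetime R N (cube I `*` [set` J]) = (r ^+ N * s)%:E.
Proof.
move=> mI mJ; rewrite EFinM -(borel_lebesgue_row_cube mI) -mJ.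
rewrite -product_measure1E; [|exact: measurable_cube|exact: measurable_itv].
apply: measurable_mu_extE; apply: measurableX; first exact: measurable_cube.
exact: measurable_itv.
Qed.

End boxes.

(** * A priori bound on the initial mass *)

Section mass.
Context {R : realType} {N : nat}.
Notation V := ('rV[R]_N * R)%type.

Lemma coord_le_enorm (x : 'rV[R]_N) i : `|x 0 i| <= enorm x.
Proof.
rewrite -sqrtr_sqr ler_sqrt; first by rewrite (bigD1 i)//= lerDl sumr_ge0// => j _; exact: sqr_ge0.
by apply: sumr_ge0 => j _; exact: sqr_ge0.
Qed.

Lemma enorm_le (x : 'rV[R]_N) r : 0 <= r -> (forall i, `|x 0 i| <= r) ->
  enorm x <= N%:R * r.
Proof.
move=> r0 xr; have Nr0 : 0 <= N%:R * r by rewrite mulr_ge0.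
rewrite -(ger0_norm Nr0) -sqrtr_sqr ler_sqrt ?sqr_ge0//.
apply: (@le_trans _ _ (\sum_(i < N) r ^+ 2)).
  apply: ler_sum => i _; rewrite -real_normK ?num_real//.
  by apply: lerXn2r; rewrite ?nnegrE.
rewrite sumr_const card_ord -[leLHS]mulr_natl exprMn ler_wpM2r ?sqr_ge0//.
by rewrite -natrX ler_nat -mulnn; case: (N) => // k; rewrite leq_pmull.
Qed.

Lemma enorm_sqr (x : 'rV[R]_N) : enorm x ^+ 2 = \sum_(i < N) x 0 i ^+ 2.
Proof. by rewrite sqr_sqrtr// sumr_ge0// => i _; exact: sqr_ge0. Qed.

Lemma box_closed r s : closed (box r s : set V).
Proof.
apply: compact_closed; last exact: box_compact.
exact: norm_hausdorff.
Qed.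

(** The function is smooth on all of space-time, so it is its own local extension.
    For [t >= 0] its support lies in the coarsest dyadic box; the margin before
    time [T] is what that box leaves. *)
Lemma multiscale_test_function (m K j0 n : nat) (T : R) :
  (0 < m)%N -> (0 < K)%N -> 2 / (2 ^+ j0.+1) ^+ (2 * m) < T ->
  test_function T (multiscale m K j0 n : V -> R).
Proof.
move=> m0 K0; set s := 2 / _ => sT.
have s0 : 0 < s by rewrite divr_gt0// !exprn_gt0.
split.
  move=> z _; exists setT, (multiscale m K j0 n); split=> //; first exact: openT.
  exact: smooth_multiscale.
exists (N%:R * 2 + 1), (T - s); split; rewrite ?subr_gt0 ?gtrBl//.
apply: (@subset_trans _ (dyadic_box m j0.+1)); last first.
  move=> z [zx zt]; split => /=; last by rewrite subKr; exact: zt.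
  rewrite /eball /= sub0r.
  apply: (@le_lt_trans _ _ (N%:R * 2)); last by rewrite ltrDl.
  apply: enorm_le => // i; rewrite mxE normrN ler_norml.
  have := zx i; rewrite /= in_itv /= => /andP[]; set r := 2 / _ => lo hi.
  have : r <= 2 by rewrite ler_pdivrMr ?exprn_gt0// ler_peMr// exprn_ege1// ler1n.
  lra.
rewrite [X in _ `<=` X](closure_id _).1; last exact: box_closed.
apply: closureS => z [[_ /=]]; rewrite in_itv /= => /andP[t0 tT] nz.
apply: gauge_dyadic_box => //.
rewrite leNgt; apply/negP => /ltW g2; move: nz.
by rewrite multiscale_eq0// eqxx.
Qed.

Lemma lebesgue_measure_bnd (b0 b1 : bool) (a b : R) : a < b ->
  lebesgue_measure [set` Interval (BSide b0 a) (BSide b1 b)] = (b - a)%:E.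
Proof. by move=> ab; rewrite lebesgue_measure_itv /= lte_fin ab EFinB. Qed.

Lemma dyadic_boxE m j : lebesgue_spacetime R N (dyadic_box m j) =
  ((4 / 2 ^+ j) ^+ N * (2 / (2 ^+ j) ^+ (2 * m)))%:E.
Proof.
have r0 : 0 < 2 / 2 ^+ j :> R by rewrite divr_gt0// exprn_gt0.
have s0 : 0 < 2 / (2 ^+ j) ^+ (2 * m) :> R by rewrite divr_gt0// !exprn_gt0.
rewrite (lebesgue_spacetime_cube (r := 4 / 2 ^+ j) (s := 2 / (2 ^+ j) ^+ (2 * m)))//.
  rewrite lebesgue_measure_bnd; last by rewrite -subr_gt0 opprK addr_gt0.
  by rewrite opprK -mulrDl -natrD.
by rewrite lebesgue_measure_bnd// subr0.
Qed.

Lemma measurable_open_slab (T : R) : measurable (open_slab T : set V).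
Proof. by apply: measurableX => //; exact: measurable_itv. Qed.

(** The solution enters only through the difference of the two space-time
    integrands, whose pointwise bound by a step function does not involve it. *)
Lemma solution_initial_mass (m K j0 n : nat) (p C T : R) mu u :
  (0 < m)%N -> 1 < p -> 1 <= K%:R * (1 - p^-1) -> 0 < C ->
  (forall z : V, 0 <= z.2 -> `|adjoint m (bump K) z| <= C * bump K z `^ p^-1) ->
  2 / (2 ^+ j0.+1) ^+ (2 * m) < T -> is_solution m p mu T u ->
  let initial := fun x => multiscale m K j0 n (x, 0) * mu x in
  (lebesgue_row R N).-integrable setT (EFin \o initial) /\
  \int[lebesgue_row R N]_x initial x <=
  \sum_(l < n) (C * K%:R / n%:R * (2 ^+ (j0 + l.+1)) ^+ (2 * m)) `^ (p / (p - 1)) *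
    ((4 / 2 ^+ (j0 + l.+1)) ^+ N * (2 / (2 ^+ (j0 + l.+1)) ^+ (2 * m))).
Proof.
move=> m0 p1 HK C0 HC sT [_ sol] initial.
have K0 : (0 < K)%N by case: K HK {HC initial} => // /[!mul0r]; lra.
have [] := sol _ (multiscale_test_function n m0 K0 sT).
rewrite -/initial => int_i int_l int_s Heq; split=> //.
have mS := measurable_lebesgue_spacetime (measurable_open_slab T).
move/eqP: Heq; rewrite addrC subr_eq addrC -subr_eq => /eqP <-.
rewrite -RintegralB//.
apply: (Rintegral_le_step mS (A := fun l : 'I_n => dyadic_box m (j0 + l.+1))).
- move=> l; apply: measurable_lebesgue_spacetime; apply: measurableX.
    exact: measurable_cube.
  exact: measurable_itv.
- by move=> l; exact: dyadic_boxE.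
- by move=> l; exact: powR_ge0.
- exact: (integrableB mS int_l int_s).
- move=> z [_ /=]; rewrite in_itv /= => /andP[/ltW t0 _].
  have := @multiscale_test _ _ m K m0 K0 p C p1 HK C0 HC j0 n z (u z) t0.
  by rewrite /adjoint mulrDr mulrN -mulNr.
Qed.

End mass.

(** * Dyadic shells *)

Section shells.
Context {R : realType} {N : nat}.
Hypothesis N0 : (0 < N)%N.
Notation V := ('rV[R]_N * R)%type.

(** One corner of a dyadic shell: on it [|x|] is comparable to [2^-i], and its
    volume is comparable to that of the whole shell, so integrals of radial
    functions are estimated from below without polar coordinates. *)
Definition shell (i : nat) : set 'rV[R]_N := cube `](2 ^+ i.+1)^-1, (2 ^+ i)^-1].

Lemma lebesgue_shell i : lebesgue_row R N (shell i) = (((2 ^+ i.+1)^-1) ^+ N)%:E.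
Proof.
have p0 : 0 < (2 ^+ i)^-1 :> R by rewrite invr_gt0 exprn_gt0.
apply: lebesgue_row_cube; rewrite lebesgue_measure_bnd; last first.
  by rewrite exprS invfM gtr_pMl// invf_lt1// ltr1n.
by congr EFin; rewrite exprS invfM; lra.
Qed.

Lemma shell_coord i x k : shell i x -> (2 ^+ i.+1)^-1 < x 0 k <= (2 ^+ i)^-1.
Proof. by move=> /(_ k); rewrite /= in_itv. Qed.

Lemma shell_enorm i x : shell i x ->
  (2 ^+ i.+1)^-1 <= enorm x /\ enorm x <= N%:R / 2 ^+ i.
Proof.
move=> sx; have p0 k : 0 < (2 ^+ k)^-1 :> R by rewrite invr_gt0 exprn_gt0.
split.
  have /andP[+ _] := shell_coord (Ordinal N0) sx; move/ltW/le_trans; apply.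
  by apply: (le_trans (ler_norm _)); exact: coord_le_enorm.
apply: enorm_le => [|k]; first exact: ltW.
have /andP[lo hi] := shell_coord k sx.
by rewrite ger0_norm// ltW// (lt_trans _ lo).
Qed.

Lemma shell_disjoint i j x : (i < j)%N -> shell i x -> ~ shell j x.
Proof.
move=> ij /(shell_coord (Ordinal N0))/andP[lo _].
move=> /(shell_coord (Ordinal N0))/andP[_ hi].
have := lt_le_trans lo hi; rewrite ltNge lef_pV2 ?posrE ?exprn_gt0// => /negP; apply.
by rewrite ler_eXn2l// ltr1n.
Qed.

Lemma shell_step_le (j k : nat) (c : nat -> R) f x : 0 <= f ->
  (forall l, (l < k)%N -> shell (j + l) x -> c l <= f) ->
  \sum_(l < k) c l * \1_(shell (j + l)) x <= f.
Proof.
move=> f0 cf.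
have [[l0 sl0]|none] := pselect (exists l : 'I_k, shell (j + l) x); last first.
  rewrite big1// => l _; rewrite indicE memNset ?mulr0// => sl.
  by apply: none; exists l.
rewrite (bigD1 l0)//= big1 ?addr0 => [|l ll0].
  by rewrite indicE mem_set// mulr1; apply: cf.
rewrite indicE memNset ?mulr0// => sl.
have [ll|ll|/val_inj/eqP] := ltngtP l l0; last by rewrite (negPf ll0).
  by apply: (@shell_disjoint (j + l) (j + l0) x) => //; rewrite ltn_add2l.
by apply: (@shell_disjoint (j + l0) (j + l) x) => //; rewrite ltn_add2l.
Qed.

Lemma shell_gauge (m j i : nat) x : (j + N <= i)%N -> shell i x ->
  gauge (dyadic m j (x, 0)) <= 1.
Proof.
move=> ji /shell_enorm[_ ub]; rewrite gauge_dyadic /= mulr0 addr0 -enorm_sqr -exprMn.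
apply: exprn_ile1; first by rewrite mulr_ge0 ?exprn_ge0// sqrtr_ge0.
apply: (@le_trans _ _ (2 ^+ j * (N%:R / 2 ^+ i))).
  by rewrite ler_wpM2l ?exprn_ge0.
rewrite mulrA ler_pdivrMr ?exprn_gt0// mul1r.
apply: (@le_trans _ _ (2 ^+ (j + N))); last by rewrite ler_eXn2l// ltr1n.
by rewrite exprD ler_wpM2l ?exprn_ge0// -natrX ler_nat ltnW// ltn_expl.
Qed.

(** The exponent [2m/(p-1) - N] is zero at the critical [p]: all scales then
    contribute equally. *)
Lemma dyadic_term (m j : nat) (p B : R) : 1 < p -> 0 <= B ->
  (B * (2 ^+ j) ^+ (2 * m)) `^ (p / (p - 1)) *
    ((4 / 2 ^+ j) ^+ N * (2 / (2 ^+ j) ^+ (2 * m))) =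
  B `^ (p / (p - 1)) * (2 * 4 ^+ N) * (2 ^+ j) `^ ((2 * m)%:R / (p - 1) - N%:R).
Proof.
move=> p1 B0; set b : R := 2 ^+ j; have b0 : 0 < b by rewrite exprn_gt0.
have q0 : p - 1 != 0 by rewrite gt_eqF// subr_gt0.
have bn0 e : (e == 0) ==> (b != 0) :> bool by rewrite gt_eqF// implybT.
rewrite powRM ?exprn_ge0 ?(ltW b0)// -powR_mulrn ?(ltW b0)// -powRrM.
rewrite (_ : (2 * m)%:R * (p / (p - 1)) = (2 * m)%:R + (2 * m)%:R / (p - 1)); last by field.
rewrite expr_div_n -(powR_mulrn N (ltW b0)) !powRD ?bn0// powRN.
set l := b `^ (2 * m)%:R; have l0 : l != 0 by rewrite gt_eqF// powR_gt0.
set s := b `^ N%:R; have s0 : s != 0 by rewrite gt_eqF// powR_gt0.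
by field; rewrite s0 l0.
Qed.

(** The test function is 1 on the shells of index at least [j0 + n + N]; the
    shift by [N] absorbs the ratio, at most [N], of the Euclidean to the sup norm,
    as [N <= 2^N]. *)
Lemma shell_mass_bound (m : nat) (p : R) : (0 < m)%N -> 1 < p ->
  exists2 C : R, 0 < C & forall (j0 n k : nat) (mu : 'rV[R]_N -> R) (T : R)
    (u : V -> R) (c : nat -> R),
  (0 < n)%N -> 2 / (2 ^+ j0.+1) ^+ (2 * m) < T -> is_solution m p mu T u ->
  (forall x, 0 <= mu x) ->
  (forall l x, (l < k)%N -> shell (j0 + n + N + l) x -> c l <= mu x) ->
  \sum_(l < k) c l * ((2 ^+ (j0 + n + N + l).+1)^-1) ^+ N <=
  C * n%:R `^ (- (p / (p - 1))) *
    \sum_(l < n) (2 ^+ (j0 + l.+1)) `^ ((2 * m)%:R / (p - 1) - N%:R).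
Proof.
move=> m0 p1; have p0 : 0 < p by apply: lt_trans p1.
have q0 : 0 < 1 - p^-1 by rewrite subr_gt0 invf_lt1.
(* Large enough for [adjoint_bump]; it affects only the constant. *)
pose K := (Num.truncn ((2 * m)%:R / (1 - p^-1))).+1.
have HK : (2 * m)%:R <= K%:R * (1 - p^-1).
  by rewrite -ler_pdivrMr// ltW// truncnS_gt.
have HK1 : 1 <= K%:R * (1 - p^-1) by apply: le_trans HK; rewrite ler1n muln_gt0.
have [C0 C00 HC] := @adjoint_bump R N m K p m0 p1 HK.
exists ((C0 * K%:R) `^ (p / (p - 1)) * (2 * 4 ^+ N)).
  by rewrite mulr_gt0 ?mulr_gt0 ?exprn_gt0// powR_gt0// mulr_gt0.
move=> j0 n k mu T u c n0 sT sol mu0 cmu.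
have [int_i] := solution_initial_mass n m0 p1 HK1 C00 HC sT sol.
set initial := fun x => _.
have CK0 : 0 <= C0 * K%:R by rewrite mulr_ge0// ltW.
under [X in _ <= X -> _]eq_bigr do rewrite (dyadic_term _ _ p1 (divr_ge0 CK0 (ler0n _ _))).
rewrite [X in _ <= X -> _](_ : _ = (C0 * K%:R) `^ (p / (p - 1)) * (2 * 4 ^+ N) *
  n%:R `^ (- (p / (p - 1))) *
  \sum_(l < n) (2 ^+ (j0 + l.+1)) `^ ((2 * m)%:R / (p - 1) - N%:R)); last first.
  have nV : 0 <= n%:R^-1 :> R by rewrite invr_ge0.
  rewrite -mulr_sumr (powRM _ CK0 nV).
  by rewrite -(powR_inv1 (ler0n R n)) -powRrM mulN1r; ring.
move=> ub; apply: le_trans ub.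
apply: (@Rintegral_ge_step _ (caratheodory_type (borel_lebesgue_row R N)^*%mu) R
  (lebesgue_row R N) k (fun l : 'I_k => shell (j0 + n + N + l)) (fun l : 'I_k => c l)
  (fun l : 'I_k => ((2 ^+ (j0 + n + N + l).+1)^-1) ^+ N) initial) => //.
- by move=> l; apply: measurable_lebesgue_row; exact: measurable_cube.
- by move=> l; exact: lebesgue_shell.
- move=> x; apply: shell_step_le.
    by rewrite /initial mulr_ge0// multiscale_ge0.
  move=> l lk sx; rewrite /initial multiscale_eq1 ?mul1r//; first exact: cmu lk sx.
  by apply: shell_gauge sx; rewrite leq_addr.
Qed.

End shells.

(** * Nonexistence *)

Section nonexistence.
Context {R : realType}.

Lemma powR_antitone (x y a : R) : 0 < x -> x <= y -> 0 <= a ->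
  y `^ (- a) <= x `^ (- a).
Proof.
move=> x0 xy a0; have y0 := lt_le_trans x0 xy.
rewrite !powRN lef_pV2 ?posrE ?powR_gt0//.
by apply: ge0_ler_powR => //; rewrite nnegrE ltW.
Qed.

Lemma exists_dyadic_lt (e : R) : 0 < e ->
  exists2 n, (0 < n)%N & (2 ^+ n)^-1 < e.
Proof.
move=> e0; exists (Num.truncn e^-1).+1 => //.
rewrite -[ltRHS]invrK ltf_pV2 ?posrE ?exprn_gt0 ?invr_gt0//.
apply: (lt_trans (truncnS_gt _)).
by rewrite -natrX ltr_nat ltn_expl.
Qed.

Lemma ln_dyadic_le (i : nat) (r : R) : (2 ^+ i.+1)^-1 <= r ->
  0 < ln (expR 1 + 1 / r) <= (i + 3)%:R.
Proof.
move=> ir; have p0 : 0 < 2 ^+ i.+1 :> R by rewrite exprn_gt0.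
have r0 : 0 < r by apply: lt_le_trans ir; rewrite invr_gt0.
have ri : 1 / r <= 2 ^+ i.+1.
  by rewrite div1r -[leRHS]invrK lef_pV2 ?posrE ?invr_gt0.
have ri0 : 0 < 1 / r by rewrite divr_gt0.
have e2 : 2 <= expR 1 :> R by have := @expR_ge1Dx R 1; lra.
have e1 : 1 < expR 1 :> R by lra.
apply/andP; split; first by rewrite ln_gt0//; lra.
rewrite -[leRHS]expRK ler_ln ?posrE ?expR_gt0 ?addr_gt0//.
have -> : (i + 3)%:R = i.+1%:R + 1 + 1 :> R by rewrite addn3 -!natr1; ring.
rewrite !expRD -[i.+1%:R]mulr1 expRM_natl.
set E := expR 1 in e2 e1 *.
have E1 : 2 ^+ i.+1 <= E ^+ i.+1 by apply: lerXn2r; rewrite ?nnegrE//; lra.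
have E2 : E <= E ^+ i.+1 by rewrite exprS ler_peMr ?exprn_ege1//; lra.
have E3 : 4 <= E * E by rewrite (_ : 4 = 2 * 2) ?ler_pM//; ring.
have : 4 * E ^+ i.+1 <= E * E * E ^+ i.+1 by rewrite ler_wpM2r// exprn_ge0//; lra.
nra.
Qed.

Lemma near_shell (N : nat) (P : 'rV[R]_N -> Prop) :
  (\forall x \near (0 : 'rV[R]_N), P x) ->
  exists2 e : R, 0 < e & forall i x, (2 ^+ i)^-1 < e -> shell i x -> P x.
Proof.
move=> /nbhs_ballP[e /= e0 eP]; exists e => // i x ie sx; apply: eP; split=> // j k.
have := shell_coord k sx; rewrite (ord1 j) !mxE /ball /= sub0r normrN => /andP[lo hi].
have p0 : 0 < (2 ^+ i.+1)^-1 :> R by rewrite invr_gt0 exprn_gt0.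
rewrite gtr0_norm ?(lt_trans p0)//; exact: le_lt_trans hi ie.
Qed.

Lemma dyadic_time_lt (m n : nat) (T : R) : (0 < m)%N ->
  (2 ^+ n)^-1 < T -> 2 / (2 ^+ n.+1) ^+ (2 * m) < T.
Proof.
move=> m0; apply: le_lt_trans.
have p0 k : 0 < 2 ^+ k :> R by rewrite exprn_gt0.
apply: (@le_trans _ _ (2 / 2 ^+ n.+1)); last first.
  by rewrite exprS invfM mulrA divff ?mul1r.
rewrite ler_wpM2l// lef_pV2 ?posrE ?exprn_gt0//.
by apply: ler_eXnr; rewrite ?muln_gt0// exprn_ege1// ler1n.
Qed.

Lemma shell_neq0 (N i : nat) (x : 'rV[R]_N) : (0 < N)%N -> shell i x ->
  0 < enorm x /\ x != 0.
Proof.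
move=> N0 /(shell_enorm N0)[lo _]; have e0 : 0 < enorm x.
  by apply: lt_le_trans lo; rewrite invr_gt0 exprn_gt0.
split=> //; apply/eqP => x0; move: e0; rewrite x0 /enorm big1 ?sqrtr0 ?ltxx// => k _.
by rewrite mxE expr0n.
Qed.

(** The [n] bumps are placed at scales [n+1] to [2n] and tested against the shells
    of index [2n+N] to [3n+N-1].  On those the logarithm is at most [(N+6) n], so
    both sides are multiples of the same power of [n], and [kap] collects the
    constants of the lower one. *)
Lemma no_solution_critical (N m : nat) (p : R) : (0 < N)%N -> (0 < m)%N ->
  p = critical_exponent R N m ->
  exists gamma1 : R, 0 < gamma1 /\
    forall mu : 'rV[R]_N -> R, (forall x, 0 <= mu x) ->
    (\forall x \near (0 : 'rV[R]_N), x != 0 ->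
      gamma1 * enorm x `^ (- N%:R) *
        ln (expR 1 + 1 / enorm x) `^ (- (N%:R / (2 * m)%:R) - 1) <= mu x) ->
    forall T : R, 0 < T -> ~ exists u, is_solution m p mu T u.
Proof.
move=> N1 m0 pE.
have NR : 0 < N%:R :> R by rewrite ltr0n.
have mR : 0 < (2 * m)%:R :> R by rewrite ltr0n muln_gt0.
have p1 : 1 < p by rewrite pE /critical_exponent ltrDl divr_gt0.
have pm1 : 0 < p - 1 by rewrite subr_gt0.
have [C C0 HC] := @shell_mass_bound R N N1 m p m0 p1.
have pow0 k : 0 < 2 ^+ k :> R by rewrite exprn_gt0.
have mR1 : m%:R != 0 :> R by rewrite pnatr_eq0 -lt0n.
have pm1E : p - 1 = (2 * m)%:R / N%:R by rewrite pE /critical_exponent addrC addKr.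
have [NR0 mR0] : N%:R != 0 :> R /\ (2 * m)%:R != 0 :> R by rewrite !gt_eqF.
pose a : R := p / (p - 1).
have aE : - (N%:R / (2 * m)%:R) - 1 = - a.
  rewrite /a pm1E pE /critical_exponent; field.
  by rewrite NR0 mR1.
have thetaE : (2 * m)%:R / (p - 1) - N%:R = 0.
  by rewrite pm1E; field; rewrite NR0 mR1.
have a0 : 0 < a by rewrite divr_gt0// (lt_trans _ p1).
pose kap : R := ((2 * N)%:R ^+ N)^-1 * (N + 6)%:R `^ (- a).
have kap0 : 0 < kap.
  by rewrite mulr_gt0 ?powR_gt0 ?invr_gt0 ?exprn_gt0 ?ltr0n ?addn_gt0 ?muln_gt0 ?N1.
exists ((C + 1) / kap); split; first by rewrite divr_gt0// addr_gt0.
move=> mu mu0 /near_shell[e e0 mu_ge] T T0 [u sol].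
have [n n0 ne] : exists2 n, (0 < n)%N & (2 ^+ n)^-1 < Num.min e T.
  by apply: exists_dyadic_lt; rewrite lt_min e0.
move: ne; rewrite lt_min => /andP[ne nT].
(* A lower bound for [mu] on a shell, from the estimates there of [|x|] and of
   the logarithm. *)
pose c l : R := (C + 1) / kap * (N%:R / 2 ^+ (n + n + N + l)) `^ (- N%:R) *
  (n + n + N + l + 3)%:R `^ (- a).
have cmu l x : (l < n)%N -> shell (n + n + N + l) x -> c l <= mu x.
  move=> ln sx; have [x0 xn0] := shell_neq0 N1 sx.
  have [lo hi] := shell_enorm N1 sx.
  apply: (le_trans _ (mu_ge (n + n + N + l)%N x _ sx xn0)); last first.
    apply: le_lt_trans ne; rewrite lef_pV2 ?posrE// ler_eXn2l ?ltr1n//.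
    by rewrite -!addnA leq_addr.
  have /andP[l0 l1] := ln_dyadic_le lo.
  have g0 : 0 <= (C + 1) / kap by rewrite divr_ge0 ?addr_ge0 ?(ltW C0) ?(ltW kap0).
  rewrite aE /c; apply: ler_pM; [exact: mulr_ge0 g0 (powR_ge0 _ _)|exact: powR_ge0| |].
    rewrite ler_wpM2l//.
    by apply: powR_antitone => //; exact: ltW.
  by apply: powR_antitone => //; exact: ltW.
have := HC n n n mu T u c n0 (dyadic_time_lt m0 nT) sol mu0 cmu.
under [X in _ <= _ * X]eq_bigr do rewrite thetaE powRr0.
rewrite sumr_const card_ord -/a => ub.
have lb : \sum_(l < n) (C + 1) * n%:R `^ (- a) <=
    \sum_(l < n) c l * ((2 ^+ (n + n + N + l).+1)^-1) ^+ N.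
  apply: ler_sum => l _; rewrite /c.
  set i := (n + n + N + l)%N.
  have -> : (N%:R / 2 ^+ i) `^ (- N%:R) = (N%:R ^+ N)^-1 * (2 ^+ i) ^+ N :> R.
    by rewrite powRN powR_mulrn ?divr_ge0 ?exprn_ge0// expr_div_n invfM invrK.
  have -> : (C + 1) / kap * ((N%:R ^+ N)^-1 * (2 ^+ i) ^+ N) * (i + 3)%:R `^ (- a) *
      (2 ^+ i.+1)^-1 ^+ N =
      (C + 1) / kap * (((2 * N)%:R ^+ N)^-1 * (i + 3)%:R `^ (- a)).
    have -> : (2 ^+ i.+1)^-1 ^+ N = (2 ^+ N)^-1 * ((2 ^+ i) ^+ N)^-1 :> R.
      by rewrite exprVn exprS exprMn invfM.
    by rewrite natrM exprMn; field; rewrite ?expf_neq0 ?gt_eqF.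
  rewrite -mulrA ler_wpM2l ?addr_ge0 ?(ltW C0)// mulrC ler_pdivlMr//.
  rewrite mulrC /kap -mulrA ler_wpM2l ?invr_ge0 ?exprn_ge0//.
  rewrite -powRM//; apply: powR_antitone; rewrite ?ltr0n ?addn3//; last exact: ltW.
  rewrite -natrM ler_nat /i.
  have := ltn_ord l; move: n0; clear; nia.
have := le_trans lb ub; rewrite sumr_const card_ord -[leLHS]mulr_natr.
rewrite ler_pM2r ?ltr0n// ler_pM2r ?powR_gt0 ?ltr0n//; lra.
Qed.

(** One bump and one shell suffice.  Both sides are multiples of the same power of
    [2^j], for every [p > 1]; the constant [kap] accounts for the shift by [N]
    between the scale of the bump and that of the shell. *)
Lemma no_solution_power (N m : nat) (p : R) : (0 < N)%N -> (0 < m)%N -> 1 < p ->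
  exists gamma1 : R, 0 < gamma1 /\
    forall mu : 'rV[R]_N -> R, (forall x, 0 <= mu x) ->
    (\forall x \near (0 : 'rV[R]_N), x != 0 ->
      gamma1 * enorm x `^ (- ((2 * m)%:R / (p - 1))) <= mu x) ->
    forall T : R, 0 < T -> ~ exists u, is_solution m p mu T u.
Proof.
move=> N1 m0 p1; have NR : 0 < N%:R :> R by rewrite ltr0n.
have mR : 0 < (2 * m)%:R :> R by rewrite ltr0n muln_gt0.
have pm1 : 0 < p - 1 by rewrite subr_gt0.
have [C C0 HC] := @shell_mass_bound R N N1 m p m0 p1.
have pow0 k : 0 < 2 ^+ k :> R by rewrite exprn_gt0.
pose th : R := (2 * m)%:R / (p - 1).
have th0 : 0 < th by rewrite divr_gt0.
pose kap : R := N%:R `^ (- th) * (2 ^+ N)^-1 * (2 ^+ N) `^ (th - N%:R).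
have kap0 : 0 < kap by rewrite !mulr_gt0 ?powR_gt0 ?invr_gt0.
exists ((C + 1) / kap); split; first by rewrite divr_gt0// addr_gt0.
move=> mu mu0 /near_shell[e e0 mu_ge] T T0 [u sol].
have [j j0 je] : exists2 j, (0 < j)%N & (2 ^+ j)^-1 < Num.min e T.
  by apply: exists_dyadic_lt; rewrite lt_min e0.
move: je; rewrite lt_min => /andP[je jT].
pose i := (j + 1 + N + 0)%N.
pose c (l : nat) : R := (C + 1) / kap * (N%:R / 2 ^+ i) `^ (- th).
have cmu l x : (l < 1)%N -> shell (j + 1 + N + l) x -> c l <= mu x.
  case: l => // _ sx; have [x0 xn0] := shell_neq0 N1 sx.
  have [lo hi] := shell_enorm N1 sx.
  apply: (le_trans _ (mu_ge _ x _ sx xn0)); last first.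
    apply: le_lt_trans je; rewrite lef_pV2 ?posrE// ler_eXn2l ?ltr1n//.
    by rewrite -!addnA leq_addr.
  have g0 : 0 <= (C + 1) / kap by rewrite divr_ge0 ?addr_ge0 ?(ltW C0) ?(ltW kap0).
  rewrite /c ler_wpM2l//.
  by apply: powR_antitone => //; exact: ltW.
have := HC j 1%N 1%N mu T u c isT (dyadic_time_lt m0 jT) sol mu0 cmu.
rewrite !big_ord1 powR1 mulr1 /c -/th -/i.
have -> : (C + 1) / kap * (N%:R / 2 ^+ i) `^ (- th) * (2 ^+ i.+1)^-1 ^+ N =
    (C + 1) * (2 ^+ (j + 1)) `^ (th - N%:R).
  rewrite /kap; set b : R := 2 ^+ (j + 1); set d : R := 2 ^+ N.
  have [b0 d0] : 0 < b /\ 0 < d by split; exact: pow0.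
  have bd0 : 0 <= b * d by rewrite mulr_ge0 ?ltW.
  have iE : 2 ^+ i = b * d :> R by rewrite /i addn0 exprD.
  have powB x : 0 < x -> x `^ (th - N%:R) = x `^ th * (x ^+ N)^-1.
    move=> x0; rewrite powRD; last by rewrite (gt_eqF x0) implybT.
    by rewrite powRN powR_mulrn// ltW.
  have -> : (N%:R / 2 ^+ i) `^ (- th) = N%:R `^ (- th) * (b `^ th * d `^ th).
    rewrite iE -(powRM _ (ltW b0) (ltW d0)) (@powRM _ N%:R) ?invr_ge0//; congr (_ * _).
    by rewrite -(powR_inv1 bd0) -powRrM mulN1r opprK.
  have -> : (2 ^+ i.+1)^-1 ^+ N = d^-1 * ((b ^+ N)^-1 * (d ^+ N)^-1).
    by rewrite exprVn exprS iE !exprMn !invfM.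
  rewrite !powB//; field.
  by rewrite !expf_neq0 ?gt_eqF ?powR_gt0.
rewrite ler_pM2r ?powR_gt0//; lra.
Qed.

End nonexistence.

Theorem corollary1p1 (R : realType) (N m : nat) (p : R) :
  (1 <= N)%N -> (2 <= m)%N -> critical_exponent R N m <= p ->
  exists gamma1 : R, 0 < gamma1 /\
    forall mu : 'rV[R]_N -> R,
      (forall x, 0 <= mu x) ->
      lebesgue_measurable_fun mu ->
      (p = critical_exponent R N m -> \forall x \near (0 : 'rV[R]_N), x != 0 ->
        gamma1 * enorm x `^ (- N%:R) *
          ln (expR 1 + 1 / enorm x) `^ (- (N%:R / (2 * m)%:R) - 1) <= mu x) ->
      (critical_exponent R N m < p -> \forall x \near (0 : 'rV[R]_N), x != 0 ->
        gamma1 * enorm x `^ (- ((2 * m)%:R / (p - 1))) <= mu x) ->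
      forall T : R, 0 < T ->
        ~ exists u : 'rV[R]_N * R -> R, is_solution m p mu T u.
Proof.
move=> N1 m2 pc; have m0 : (0 < m)%N by apply: ltnW.
have [pE|pN] := eqVneq p (critical_exponent R N m).
  have [g [g0 H]] := no_solution_critical N1 m0 pE.
  by exists g; split=> // mu mu0 _ /(_ pE) mu_ge _; exact: H.
have plt : critical_exponent R N m < p by rewrite lt_neqAle eq_sym pN.
have p1 : 1 < p.
  apply: lt_trans plt; rewrite /critical_exponent ltrDl divr_gt0//.
    by rewrite ltr0n muln_gt0.
  by rewrite ltr0n.
have [g [g0 H]] := no_solution_power N1 m0 p1.
by exists g; split=> // mu mu0 _ _ /(_ plt) mu_ge; exact: H.
Qed.
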